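(* Let $A$ be a Krein's string with associated functions $R(z,\lambda)$ and $\psi(\lambda)$. For $f\in\mathcal D(\psi(-L))$, the function $$v(\cdot,z)=R(z,-L)f,\qquad z\ge0,$$ is an $L^2$-weak solution of $$A(z)Lv(x,z)+v_{zz}(x,z)=0\ \text{ in } X\times(0,\infty),\qquad v(x,0)=f(x)\ \text{ in } X.$$ In particular, for all $g\in L^2(X,\mu)$, $$\bigl\langle A(z)Lv(\cdot,z)+v_{zz}(\cdot,z),\,g\bigr\rangle_{L^2(X,\mu)}=0 .$$ Moreover, the Dirichlet-to-Neumann condition $\psi(-L)f=-\lim_{z\to0^+}v_z(\cdot,z)$ holds weakly in $L^2(X,\mu)$.
   Context: $(X,d)$ is a locally compact metric space with a Radon measure $\mu$ supported on $X$. $(\mathcal E,\mathcal F)$ is a Dirichlet form on $L^2(X,\mu)$ (densely defined, closed, symmetric, Markovian bilinear form), and $L$ is its generator: the non-positive self-adjoint operator on $L^2(X,\mu)$ with $\mathcal F=\mathcal D(\sqrt{-L})$ and $\mathcal E(u,v)=\langle\sqrt{-L}u,\sqrt{-L}v\rangle$. It is assumed that $L$ has no spectral gap, i.e. the spectrum of $-L$ meets $(0,\varepsilon)$ for every $\varepsilon>0$. With $-L=\int_0^\infty\lambda\,dE(\lambda)$, for non-negative continuous $\phi$ on $[0,\infty)$ set $\phi(-L)=\int_0^\infty\phi(\lambda)\,dE(\lambda)$, with domain $\mathcal D(\phi(-L))=\{u\in L^2(X,\mu):\int_0^\infty\phi(\lambda)^2\,dE_{u,u}(\lambda)<\infty\}$.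 $R(z,-L)$ is defined in this way from $\lambda\mapsto R(z,\lambda)$. A Krein's string is a non-negative locally integrable function $A$ on $[0,+\infty)$. It is known that for every $\lambda\ge0$ there is a unique non-increasing function $R(\cdot,\lambda)$ on $[0,+\infty)$ with $$R_{zz}(z,\lambda)=\lambda A(z)R(z,\lambda)\ (z>0),\qquad R(0,\lambda)=1,\qquad \lim_{z\to+\infty}R(z,\lambda)\ge0$$ (second derivative in the weak sense), and that $\psi(\lambda)=-R_z(0,\lambda)$ defines a complete Bernstein function. In the equation for $v$, second derivatives in $z$ are understood in the weak sense and the operators applied to $f$ are understood through the spectral theorem, i.e. tested against $g\in L^2(X,\mu)$ via the measures $dE_{f,g}(\lambda)$. *)

(* Defs.v *)
From HB Require Import structures.
From mathcomp Require Import all_boot all_order all_algebra.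
From mathcomp Require Import all_classical all_reals all_analysis.
From mathcomp Require Import measurable_realfun.
Set Implicit Arguments.
Unset Strict Implicit.
Unset Printing Implicit Defensive.
Import Order.TTheory GRing.Theory Num.Theory.
Import numFieldNormedType.Exports.
Local Open Scope classical_set_scope.
Local Open Scope ring_scope.

(* Measurable types of the library are pointed, hence the nonempty metric
   spaces. *)
#[short(type="pmetricType")]
HB.structure Definition PMetric (K : numDomainType) :=
  {M of Metric K M & Pointed M}.

Notation borel X := (g_sigma_algebraType (@open X)).

Definition radon_measure (R : realType) (X : pmetricType R)
    (mu : {measure set (borel X) -> \bar R}) : Prop :=
  [/\ (forall K : set X, compact K -> (mu K < +oo)%E),
      (forall B : set X, (@open X).-sigma.-measurable B ->
         mu B = ereal_inf [set mu U | U in [set U : set X | open U /\ B `<=` U]])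
    & (forall U : set X, open U ->
         mu U = ereal_sup
           [set mu K | K in [set K : set X | compact K /\ K `<=` U]])].

Definition full_support (R : realType) (X : pmetricType R)
    (mu : {measure set (borel X) -> \bar R}) : Prop :=
  forall U : set X, open U -> U !=set0 -> (0 < mu U)%E.

(* Elements of [L2 mu] are square integrable functions, not classes: equality
   in L^2 is [u = v %[ae mu]], and "u in a subset of L^2" is only meaningful for
   sets that are saturated for this relation. *)
Notation L2 mu := (LfunType mu (lee1n 2)).

Section L2_space.
Context d (T : measurableType d) (R : realType).
Variable mu : {measure set T -> \bar R}.
Local Notation H := (L2 mu).

Definition l2dot (u v : H) : R := \int[mu]_x (u x * v x).

Definition l2norm (u : H) : R := Num.sqrt (l2dot u u).

Definition ae_saturated (D : set H) : Prop :=
  forall u v : H, D u -> u = v %[ae mu] -> D v.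

Definition subspace (D : set H) : Prop :=
  [/\ ae_saturated D, D 0 & forall (a : R) (u v : H), D u -> D v -> D (a *: u + v)].

Definition l2dense (D : set H) : Prop :=
  forall (u : H) (e : R), 0 < e -> exists2 v, D v & l2norm (u - v) < e.

Definition symmetric_form (F : set H) (E : H -> H -> R) : Prop :=
  [/\ (forall u v w : H, F u -> F w -> u = v %[ae mu] -> E u w = E v w),
      (forall (a : R) (u v w : H), F u -> F v -> F w ->
         E (a *: u + v) w = a * E u w + E v w),
      (forall u v : H, F u -> F v -> E u v = E v u)
    & (forall u : H, F u -> 0 <= E u u)].

Definition form1 (E : H -> H -> R) (u v : H) : R := E u v + l2dot u v.

Definition closed_form (F : set H) (E : H -> H -> R) : Prop :=
  forall u_ : nat -> H, (forall n, F (u_ n)) ->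
    (forall e : R, 0 < e -> exists N : nat, forall m n : nat,
       (N <= m)%N -> (N <= n)%N -> form1 E (u_ m - u_ n) (u_ m - u_ n) < e) ->
    exists2 u, F u & form1 E (u_ n - u) (u_ n - u) @[n --> \oo] --> (0 : R).

Definition markovian (F : set H) (E : H -> H -> R) : Prop :=
  forall u w : H, F u -> (forall x, w x = Num.min (Num.max (u x) 0) 1) ->
    F w /\ E w w <= E u u.

Definition dirichlet_form (F : set H) (E : H -> H -> R) : Prop :=
  [/\ subspace F, l2dense F, symmetric_form F E, closed_form F E & markovian F E].

(* Operators are total functions, only relevant on their domain [D]. *)
Definition linear_on (D : set H) (T : H -> H) : Prop :=
  forall (a : R) (u v : H), D u -> D v ->
    T (a *: u + v) = a *: T u + T v %[ae mu].

(* The last clause says that the domain of the adjoint is contained in [D]. *)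
Definition self_adjoint (D : set H) (T : H -> H) : Prop :=
  [/\ subspace D, l2dense D, linear_on D T,
      (forall u v : H, D u -> D v -> l2dot (T u) v = l2dot u (T v))
    & (forall u w : H, (forall v, D v -> l2dot u (T v) = l2dot w v) -> D u)].

Definition nonpositive_op (D : set H) (T : H -> H) : Prop :=
  forall u : H, D u -> l2dot (T u) u <= 0.

Definition opp_op (T : H -> H) : H -> H := fun u => - T u.

Definition resolvent_point (D : set H) (T : H -> H) (a : R) : Prop :=
  exists S : H -> H,
    [/\ (exists C : R, forall u, l2norm (S u) <= C * l2norm u),
        (forall u, D (S u) /\ T (S u) - a *: S u = u %[ae mu])
      & (forall u, D u -> S (T u - a *: u) = u %[ae mu])].

(* Only the real points of the spectrum, which are all of them for a
   self-adjoint operator. *)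
Definition spectrum (D : set H) (T : H -> H) : set R :=
  [set a | ~ resolvent_point D T a].

Definition no_spectral_gap (D : set H) (L : H -> H) : Prop :=
  forall e : R, 0 < e -> exists a : R, [/\ 0 < a, a < e & spectrum D (opp_op L) a].

End L2_space.

Section charge_integral.
Context d (T : measurableType d) (R : realType).
Variable nu : {charge set T -> \bar R}.

Definition hahn_pos : set T := projT1 (cid (Hahn_decomposition nu)).
Definition hahn_neg : set T :=
  projT1 (cid (projT2 (cid (Hahn_decomposition nu)))).
Definition hahnP : hahn_decomposition nu hahn_pos hahn_neg :=
  projT2 (cid (projT2 (cid (Hahn_decomposition nu)))).

Definition charge_integrable (D : set T) (phi : T -> R) : Prop :=
  (charge_variation hahnP).-integrable D (EFin \o phi).

Definition charge_integral (D : set T) (phi : T -> R) : R :=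
  \int[jordan_pos hahnP]_(x in D) phi x - \int[jordan_neg hahnP]_(x in D) phi x.

End charge_integral.

Section spectral_calculus.
Context d (T : measurableType d) (R : realType).
Variable mu : {measure set T -> \bar R}.
Local Notation H := (L2 mu).

(* The spectral measure [E] of [-L], concentrated on [0, +oo). *)
Record resolution := Resolution {
  proj :> set (measurableTypeR R) -> H -> H;
  proj_sym : forall B, measurable B ->
    forall u v, l2dot (proj B u) v = l2dot u (proj B v);
  proj_linear : forall B, measurable B -> linear_on setT (proj B);
  proj0 : forall u, proj set0 u = 0 %[ae mu];
  projT : forall u, proj setT u = u %[ae mu];
  projI : forall B C, measurable B -> measurable C ->
    forall u, proj (B `&` C) u = proj B (proj C u) %[ae mu];
  proj_sigma : forall u v,
    semi_sigma_additive (fun B => (l2dot (proj B u) v)%:E);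
  proj_ge0 : forall u, proj `[0, +oo[%classic u = u %[ae mu] }.

Definition spectral_charge (P : resolution) (u v : H) :
  set (measurableTypeR R) -> \bar R := fun B => (l2dot (P B u) v)%:E.

Section spectral_charge_instance.
Variables (P : resolution) (u v : H).

Let spectral_charge0 : spectral_charge P u v set0 = 0%E.
Proof.
rewrite /spectral_charge /l2dot /Rintegral.
have -> : (\int[mu]_x (P set0 u x * v x)%:E = \int[mu]_x (cst 0 x))%E.
  apply: ae_eq_integral => //.
    by apply/measurable_EFinP; apply: measurable_funM.
  by apply: filterS (proj0 P u) => x /= -> // _; rewrite mul0r.
by rewrite integral0.
Qed.

Let spectral_charge_fin B : measurable B -> spectral_charge P u v B \is a fin_num.
Proof. by []. Qed.

HB.instance Definition _ := isCharge.Build _ _ R (spectral_charge P u v)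
  spectral_charge0 spectral_charge_fin (@proj_sigma P u v).

End spectral_charge_instance.

(* For [u = v] the charge is nonnegative, so it is its own variation. *)
Definition fdomain (P : resolution) (phi : R -> R) : set H :=
  [set u | charge_integrable (spectral_charge P u u) `[0, +oo[
             (fun a => phi a ^+ 2)].

(* The pairing of [phi(-L) u] with [g] *)
Definition fpairing (P : resolution) (phi : R -> R) (u g : H) : R :=
  charge_integral (spectral_charge P u g) `[0, +oo[ phi.

Definition fpairing_defined (P : resolution) (phi : R -> R) (u g : H) : Prop :=
  charge_integrable (spectral_charge P u g) `[0, +oo[ phi.

(* A representative of [phi(-L) u]; meaningless unless [u] is in the domain. *)
Definition fcalc (P : resolution) (phi : R -> R) (u : H) : H :=
  xget 0 [set w | forall g,
            fpairing_defined P phi u g /\ l2dot w g = fpairing P phi u g].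

(* [-L] is the integral of [a dP(a)], equality of domains included. *)
Definition resolution_of_opp (P : resolution) (D : set H) (L : H -> H) : Prop :=
  (forall u, D u <-> fdomain P id u) /\
  (forall u, D u -> opp_op L u = fcalc P id u %[ae mu]).

(* [P] is the resolution of the identity of [-L], through which the square root
   of [-L] is defined. *)
Definition generator_of (P : resolution) (F : set H) (E : H -> H -> R) : Prop :=
  (forall u, F u <-> fdomain P Num.sqrt u) /\
  (forall u v, F u -> F v ->
     E u v = l2dot (fcalc P Num.sqrt u) (fcalc P Num.sqrt v)).

End spectral_calculus.

Section krein.
Variable R : realType.
Local Notation leb := (@lebesgue_measure R).

Definition krein_string (A : R -> R) : Prop :=
  (forall z, 0 <= z -> 0 <= A z) /\
  (forall b, 0 <= b -> leb.-integrable `[0, b] (EFin \o A)).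

(* Smooth functions with compact support in (0, +oo) *)
Definition test_function (eta : R -> R) : Prop :=
  (forall (n : nat) x, derivable (derive1n n eta) x 1) /\
  (exists a b : R, 0 < a /\ forall x, eta x != 0 -> a <= x <= b).

(* [h'' = w] on (0, +oo) in the sense of distributions *)
Definition weak_deriv2 (h w : R -> R) : Prop :=
  [/\ locally_integrable `]0, +oo[ h, locally_integrable `]0, +oo[ w
    & forall eta, test_function eta ->
        \int[leb]_(z in `]0, +oo[) (h z * derive1n 2 eta z) =
        \int[leb]_(z in `]0, +oo[) (w z * eta z)].

(* The boundary value at 0 is attained continuously: weak solutions on (0, +oo)
   do not see the value at 0, and uniqueness fails otherwise. *)
Definition krein_solution (A : R -> R) (a : R) (r : R -> R) : Prop :=
  [/\ {in `[0, +oo[ &, {homo r : x y /~ x <= y}},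
      weak_deriv2 r (fun z => a * A z * r z),
      r 0 = 1 /\ r z @[z --> 0^'+] --> (1 : R)
    & exists2 l : R, r z @[z --> +oo] --> l & 0 <= l].

(* psi(a) = - d/dz r(z, a) at z = 0, a one-sided derivative *)
Definition krein_psi (r : R -> R -> R) (a : R) : R :=
  - lim ((r h a - r 0 a) / h @[h --> 0^'+]).

End krein.

Section extension.
Context d (T : measurableType d) (R : realType).
Variable mu : {measure set T -> \bar R}.
Local Notation H := (L2 mu).

(* [A(z) L R(z, -L)] is the function [- A(z) a R(z, a)] of [-L]. *)
Definition ALv_symbol (A : R -> R) (r : R -> R -> R) (z a : R) : R :=
  A z * (- a * r z a).

(* For every [g], [<A(z) L v(z), g> + d^2/dz^2 <v(z), g> = 0] weakly in [z]. *)
Definition extension_weak_solution (P : resolution mu) (A : R -> R)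
    (r : R -> R -> R) (f : H) (v : R -> H) : Prop :=
  forall g : H,
    {ae (@lebesgue_measure R),
      forall z, 0 < z -> fpairing_defined P (ALv_symbol A r z) f g} /\
    weak_deriv2 (fun z => l2dot (v z) g)
                (fun z => - fpairing P (ALv_symbol A r z) f g).

(* [w] is the derivative of [v] at [z] for the weak topology of L^2. *)
Definition is_weak_derive (v : R -> H) (z : R) (w : H) : Prop :=
  forall g : H, is_derive z (1 : R) (fun s => l2dot (v s) g) (l2dot w g).

Definition weak_lim0 (w : R -> H) (l : H) : Prop :=
  forall g : H, l2dot (w z) g @[z --> 0^'+] --> l2dot l g.

End extension.

(* Main.v *)
Require Import Defs.
From mathcomp Require Import all_boot all_order all_algebra.
From mathcomp Require Import all_classical all_reals all_analysis.
From mathcomp Require Import measurable_realfun.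
From mathcomp Require Import ring lra.
(* For each [a >= 0], testing the weak equation against second primitives of
   smooth bumps shows that [r z a] minus the second primitive in [z] of
   [a A r] is affine, so that [r z a = 1 - psi(a) z + int_0^z int_0^s a A r]; hence
   [- psi(a) <= r_z <= 0], and [int_0^b a A r dz <= psi(a)]. A maximum principle
   makes [r z a] monotone in [a], which gives joint measurability. If [rho] is a
   finite measure that integrates [psi], Fubini turns the equations for the
   [r z a] into the weak equation for [z |-> int r z a drho(a)], and domination
   by [psi] allows differentiation under the integral and the limit [z -> 0+].
   This applies to the positive and negative parts of [nu_fg = <dE f, g>]:
   Cauchy-Schwarz for the projections gives
   [2 c |nu_fg|(B) <= c^2 nu_ff(B) + nu_gg(B)] for all sets [B], hence
   [2 int phi d|nu_fg| <= int phi^2 dnu_ff + <g, g>] for [phi >= 0], so that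
   [psi], which is square integrable for [nu_ff], is integrable for [|nu_fg|],
   and, with the completeness of L^2, [phi(-L) f] exists as a vector. *)
Set Implicit Arguments.
Unset Strict Implicit.
Unset Printing Implicit Defensive.
Import Order.TTheory GRing.Theory Num.Theory.
Import numFieldNormedType.Exports.
Local Open Scope classical_set_scope.
Local Open Scope ring_scope.

(** * Smooth test functions *)

(** The definition of a solution gives little regularity: [r z a] is only monotone in [z], and
    nothing is assumed on how it depends on [a]. Monotonicity makes up for both. In [z], a weighted
    mean of a nonincreasing function over [[x, x + e]] lies between its end values, so that the weak
    equation tested against narrow bumps becomes an inequality between values, without mollification
    or Lebesgue points. In [a], monotonicity has to be proved, and replaces any assumed
    measurability. The comparison of [|nu_fg|] with [nu_ff] and [nu_gg] keeps a free parameter [c]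
    instead of the square roots of Cauchy-Schwarz: for fixed [c] all its terms are additive in the
    set, so taking for [c] the value of a simple function on each level set and summing gives the
    inequality for integrals. With [g] the difference of two approximating vectors, half of the term
    [<g, g>] is absorbed, which proves the Cauchy property without a product formula for the
    functional calculus. *)

Section smooth_functions.
Variable R : realType.
Implicit Types (f g : R -> R) (n : nat) (x : R).

(** Derivatives are provided as witnesses rather than computed, so that closure under sums, products
    and affine changes of variable is a plain induction; [Cn_derivable] returns to the iterated
    derivatives that [test_function] uses. *)
Fixpoint Cn n f : Prop :=
  if n is n'.+1 then
    exists2 df : R -> R, (forall x, is_derive x (1 : R) f (df x)) & Cn n' df
  else continuous f.

Definition smooth f := forall n, Cn n f.

Lemma CnW n f : Cn n.+1 f -> Cn n f.
Proof.
elim: n f => [|n IH] f [df fdf Cdf].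
  move=> x; apply: differentiable_continuous; apply/derivable1_diffP.
  by have [] := fdf x.
by exists df => //; exact: IH.
Qed.

Lemma CnD n f g : Cn n f -> Cn n g -> Cn n (f + g).
Proof.
elim: n f g => [|n IH] f g; first by move=> cf cg x; exact: cvgD (cf x) (cg x).
move=> [df fdf Cdf] [dg gdg Cdg].
by exists (df + dg) => [x|]; [exact: is_deriveD|exact: IH].
Qed.

Lemma CnM n f g : Cn n f -> Cn n g -> Cn n (f * g).
Proof.
elim: n f g => [|n IH] f g; first by move=> cf cg x; exact: cvgM (cf x) (cg x).
move=> /[dup] /CnW Cf [df fdf Cdf] /[dup] /CnW Cg [dg gdg Cdg].
exists (f * dg + g * df) => [x|]; first exact: is_deriveM.
by apply: CnD; exact: IH.
Qed.

Lemma Cn_cst n (c : R) : Cn n (cst c).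
Proof.
elim: n c => [|n IH] c; first by move=> x; exact: cvg_cst.
by exists (cst 0) => [x|]; [exact: is_derive_cst|exact: IH].
Qed.

Lemma Cn_comp_affine n f (c d : R) : Cn n f -> Cn n (fun x => f (c * x + d)).
Proof.
elim: n f => [|n IH] f /=.
  move=> cf x; apply: (@continuous_comp _ _ _ (fun y => c * y + d) f); last exact: cf.
  by apply: cvgD; [apply: cvgM; [exact: cvg_cst|exact: cvg_id]|exact: cvg_cst].
move=> [df fdf Cdf].
exists ((cst c) * (fun x => df (c * x + d))); last first.
  by apply: CnM; [exact: Cn_cst|exact: IH].
move=> x; have lx : is_derive x (1 : R) (fun y : R => c * y + d) c.
  have := is_deriveD (is_deriveZ c (is_derive_id x (1 : R))) (is_derive_cst d x (1 : R)).
  by rewrite addr0 scaler1.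
have := @is_derive1_comp _ f (fun y => c * y + d) x _ _ (fdf _) lx.
by rewrite /comp mulrC.
Qed.

Lemma is_derive_derive1 f df : (forall x, is_derive x (1 : R) f (df x)) ->
  derive1 f = df.
Proof. by move=> fdf; apply/funext => x; rewrite derive1E derive_val. Qed.

Lemma Cn_derivable n f : Cn n.+1 f -> forall x, derivable (derive1n n f) x 1.
Proof.
elim: n f => [|n IH] f [df fdf Cdf] x; first by rewrite derive1n0; have [] := fdf x.
by rewrite derive1Sn (is_derive_derive1 fdf); exact: IH.
Qed.

Lemma smooth_derivable f : smooth f -> forall n x, derivable (derive1n n f) x 1.
Proof. by move=> sf n; apply: Cn_derivable; exact: sf. Qed.

(** A single term of the exponential series bounds each power: [y ^+ i] is at most [(i + 1)!] times
    [expR y]. *)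
Lemma poly_expRN_bounded (P : {poly R}) :
  exists C : R, forall y, 0 < y -> `|P.[y]| * expR (- y) <= C.
Proof.
exists (\sum_(i < size P) `|P`_i| * (i.+1`!)%:R) => y y0.
rewrite horner_coef (le_trans (ler_wpM2r (expR_ge0 _) (ler_norm_sum _ _ _)))//.
rewrite mulr_suml ler_sum// => i _.
rewrite normrM -mulrA ler_wpM2l// normrX (gtr0_norm y0) expRN.
rewrite ler_pdivrMr ?expR_gt0//.
case: (nat_of_ord i) => [|k].
  rewrite expr0 mul1r; have := expR_gt1 y; rewrite y0 => /ltW//.
apply: (@le_trans _ _ ((k.+1)`!%:R * expR y)).
  have yk := expR_ge1Dxn k (ltW y0).
  rewrite mulrC -ler_pdivrMr ?ltr0n ?fact_gt0//.
  by rewrite (le_trans _ yk)// lerDr.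
by rewrite ler_wpM2r ?expR_ge0// ler_nat [in leqRHS]factS leq_pmull.
Qed.

(** [flat 1] is the classical [exp(-1/x)]. The polynomial factor in [1/x] makes the family stable
    under differentiation, which is what lets the induction for smoothness go through. *)
Definition flat (P : {poly R}) x : R :=
  if x <= 0 then 0 else P.[x^-1] * expR (- x^-1).

(* [d/dx (P(1/x) exp(-1/x)) = Q(1/x) exp(-1/x)] with [Q = X^2 (P - P')]. *)
Lemma is_derive_flat (P : {poly R}) x :
  is_derive x (1 : R) (flat P) (flat ('X^2 * (P - P^`())) x).
Proof.
have [x0|x0|->] := ltgtP x 0.
- rewrite [flat _ x]/flat (ltW x0).
  apply: (@near_eq_is_derive _ _ _ (cst 0)).
  near=> y; rewrite /flat ifT//; near: y; apply: filterS (lt_nbhsl x0) => z; exact: ltW.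
- have xn0 : x != 0 by rewrite gt_eqF.
  have eqf : \near x, P.[x^-1] * expR (- x^-1) = flat P x.
    near=> y; rewrite /flat leNgt ifF//; apply/negbTE; rewrite negbK.
    by near: y; exact: lt_nbhsr.
  apply: (near_eq_is_derive eqf).
  have dV : is_derive x (1 : R) (fun y : R => y^-1) (- x ^- 2).
    by have := is_deriveV xn0 (is_derive_id x (1 : R)); rewrite scaler1.
  have dP := @is_derive1_comp _ (horner P) (fun y => y^-1) x _ _ (is_derive_poly P _) dV.
  have dE := @is_derive1_comp _ expR (fun y => - y^-1) x _ _ (is_derive_expR _) (is_deriveN dV).
  apply: (@is_derive_eq _ _ _ _ _ _ _ _ (is_deriveM dP dE)); rewrite /flat leNgt x0/=.
  rewrite hornerM hornerXn hornerD hornerN /GRing.scale/=; field; exact: xn0.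
- rewrite {2}/flat lexx.
  (* The factor [X^2] supplies two powers of [h]: one pays for the difference quotient at 0, the
     other makes it [O(h)]. *)
  have [C hC] := poly_expRN_bounded ('X^2 * P).
  have C0 : 0 <= C.
    by apply: le_trans (hC 1 ltr01); rewrite mulr_ge0// expR_ge0.
  have bd h : `|h^-1 * flat P h| <= C * `|h|.
    rewrite /flat; case: ifPn => [_|]; first by rewrite mulr0 normr0 mulr_ge0.
    rewrite -ltNge => h0; have hV : 0 < h^-1 by rewrite invr_gt0.
    have := hC _ hV; rewrite hornerM hornerXn !normrM (gtr0_norm h0) (gtr0_norm hV).
    rewrite [`|expR _|]ger0_norm ?expR_ge0// => hh.
    apply: le_trans (ler_wpM2r (ltW h0) hh).
    by rewrite le_eqVlt; apply/orP; left; apply/eqP; field; rewrite gt_eqF.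
  have lim0 : h^-1 *: ((flat P \o shift 0) (h *: (1 : R)) - flat P 0) @[h --> 0^'] --> (0 : R).
    apply: (@cvg_to_0_linear _ _ C 1) => // h _.
    by rewrite /= [flat P 0]/flat lexx subr0 addr0 [h *: 1]mulr1 bd.
  apply: DeriveDef; first by apply/cvg_ex; exists 0.
  exact: cvg_lim lim0.
Unshelve. all: end_near. Qed.

Lemma smooth_flat P : smooth (flat P).
Proof.
move=> n; elim: n P => [|n IH] P; last first.
  by exists (flat ('X^2 * (P - P^`()))) => // x; exact: is_derive_flat.
move=> x; apply: differentiable_continuous; apply/derivable1_diffP.
by have [] := is_derive_flat P x.
Qed.

Definition bump x := flat 1 x * flat 1 (1 - x).

Lemma smooth_bump : smooth bump.
Proof.
move=> n; apply: CnM; first exact: smooth_flat.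
rewrite (_ : (fun x => flat 1 (1 - x)) = (fun x => flat 1 (-1 * x + 1))); last first.
  by apply/funext => x; rewrite mulN1r addrC.
by apply: Cn_comp_affine; exact: smooth_flat.
Qed.

Lemma flat1_ge0 x : 0 <= flat 1 x.
Proof. by rewrite /flat; case: ifPn => // _; rewrite hornerC mul1r expR_ge0. Qed.

Lemma bump_ge0 x : 0 <= bump x.
Proof. by rewrite mulr_ge0 ?flat1_ge0. Qed.

Lemma bump_gt0 x : 0 < x < 1 -> 0 < bump x.
Proof.
move=> /andP[x0 x1]; rewrite /bump /flat !leNgt x0 subr_gt0 x1/= !hornerC !mul1r.
by rewrite mulr_gt0 ?expR_gt0.
Qed.

Lemma bump_eq0 x : ~~ (0 < x < 1) -> bump x = 0.
Proof.
rewrite negb_and -!leNgt => /orP[x0|x1]; rewrite /bump /flat.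
  by rewrite x0 mul0r.
by rewrite subr_le0 x1 mulr0.
Qed.

Lemma primitive_from0 f : continuous f -> (forall x, x <= 0 -> f x = 0) ->
  exists2 F : R -> R, (forall x, is_derive x (1 : R) F (f x)) &
    forall x, x <= 0 -> F x = 0.
Proof.
move=> cf f0.
(* Starting at -1 makes 0 an interior point, where the fundamental theorem applies; [f] vanishes on
   the added piece. *)
pose F x := \int[@lebesgue_measure R]_(t in `[-1, x]) f t.
have F0 x : x <= 0 -> F x = 0.
  move=> x0; rewrite /F (@eq_Rintegral _ _ _ _ _ (cst 0)) ?Rintegral_cst ?mul0r//.
  by move=> t; rewrite inE/= in_itv/= => /andP[_ tx]; rewrite f0// (le_trans tx).
exists F => // x; have [x0|x0] := ltP x 0.
  rewrite f0; last exact: ltW.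
  apply: (@near_eq_is_derive _ _ _ (cst 0)).
  by near=> y; rewrite F0//; apply: ltW; near: y; exact: lt_nbhsl.
have xx1 : x < x + 1 by rewrite ltrDl.
have m1x : -1 < x by rewrite (lt_le_trans _ x0)// ltrN10.
have intf : (@lebesgue_measure R).-integrable `[-1, x + 1] (EFin \o f).
  apply: continuous_compact_integrable; first exact: segment_compact.
  exact: continuous_subspaceT.
have [dF F'] := continuous_FTC1_closed xx1 intf m1x (cf x).
by apply: DeriveDef; [exact: dF|rewrite -derive1E F'].
Unshelve. all: end_near. Qed.

Lemma derive0_cst (F : R -> R) (a : R) : (forall x, a <= x -> is_derive x (1 : R) F 0) ->
  forall x, a <= x -> F x = F a.
Proof.
move=> dF x; rewrite le_eqVlt => /predU1P[->//|ax].
have [||c _ /eqP] := @MVT _ F (cst 0) _ _ ax.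
- by move=> y; rewrite in_itv/= => /andP[/ltW ay _]; exact: dF.
- apply: derivable_within_continuous => y; rewrite in_itv/= => /andP[ay _].
  by have [] := dF _ ay.
- by rewrite mul0r subr_eq0 => /eqP.
Qed.

(** [K] is a smoothed multiple of the positive part: zero to the left of 0 and affine to the right
    of 1, with slope the total mass [m] of the bump. *)
Lemma bump_primitives : exists (K1 K : R -> R) (m : R),
  [/\ 0 < m, (forall x, is_derive x (1 : R) K1 (bump x)),
      (forall x, is_derive x (1 : R) K (K1 x)),
      (forall x, x <= 0 -> K1 x = 0 /\ K x = 0) &
      (forall x, 1 <= x -> K1 x = m /\ K x = m * (x - 1) + K 1)].
Proof.
have b0 x : x <= 0 -> bump x = 0.
  by move=> x0; apply: bump_eq0; rewrite negb_and -!leNgt x0.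
have b1 x : 1 <= x -> bump x = 0.
  by move=> x1; apply: bump_eq0; rewrite negb_and -!leNgt x1 orbT.
have [K1 dK1 K10] := primitive_from0 (smooth_bump 0) b0.
have cK1 : continuous K1.
  move=> x; apply: differentiable_continuous; apply/derivable1_diffP.
  by have [] := dK1 x.
have [K dK K0] := primitive_from0 cK1 K10.
have K11 x : 1 <= x -> K1 x = K1 1.
  by apply: derive0_cst => y /b1 <-; exact: dK1.
exists K1, K, (K1 1); split => //.
- have [c c01] := MVT ltr01 (fun y _ => dK1 y) (continuous_subspaceT cK1).
  rewrite (K10 0)// !subr0 mulr1 => ->; apply: bump_gt0.
    by move: c01; rewrite in_itv.
- by move=> x x0; rewrite K10// K0.
- move=> x x1; split; first exact: K11.
  have dL (y : R) : 1 <= y -> is_derive y (1 : R) (fun t => K t - (K1 1 * t)) 0.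
    move=> y1; apply: (@is_derive_eq _ _ _ _ _ _ _ _ (is_deriveB (dK y)
      (is_deriveZ (K1 1) (is_derive_id y (1 : R))))).
    by rewrite (K11 _ y1) /GRing.scale/= mulr1 subrr.
  have := derive0_cst dL x1 => /=; lra.
Qed.

(** A smoothed tent with vertices [x], [y], [z]. The barycentric relations cancel the affine parts
    of the three translates of [K] beyond [z + e], so the support is compact, while the second
    derivative consists of three bumps of width [e]. Testing with it compares means of a function
    near [y] with means near [x] and [z]. *)
Lemma test_function_kernel K1 K (m : R) (x y z e al be : R) :
    (forall x, is_derive x (1 : R) K1 (bump x)) ->
    (forall x, is_derive x (1 : R) K (K1 x)) ->
    (forall x, x <= 0 -> K1 x = 0 /\ K x = 0) ->
    (forall x, 1 <= x -> K1 x = m /\ K x = m * (x - 1) + K 1) ->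
    0 < x -> 0 < e -> x < y -> y < z -> al + be = 1 -> al * x + be * z = y ->
  let eta := fun t => al * K ((t - x) / e) - K ((t - y) / e) + be * K ((t - z) / e) in
  test_function eta /\
  derive1n 2 eta = (fun t => e ^- 2 *
    (al * bump ((t - x) / e) - bump ((t - y) / e) + be * bump ((t - z) / e))).
Proof.
move=> dK1 dK K0 Km x0 e0 xy yz albe alxbez eta.
have en0 : e != 0 by rewrite gt_eqF.
have dsh (g dg : R -> R) w : (forall x, is_derive x (1 : R) g (dg x)) ->
    forall t, is_derive t (1 : R) (fun t => g ((t - w) / e)) (e^-1 * dg ((t - w) / e)).
  move=> gdg t; have lt : is_derive t (1 : R) (fun s => (s - w) / e) e^-1.
    have := is_deriveZ e^-1 (is_deriveB (is_derive_id t (1 : R)) (is_derive_cst w t (1 : R))).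
    rewrite subr0 [_ *: 1]mulr1; congr is_derive; apply/funext => s /=.
    by rewrite [RHS]mulrC.
  have := @is_derive1_comp _ g (fun s => (s - w) / e) t _ _ (gdg _) lt.
  by rewrite mulrC.
have dcomb (g dg : R -> R) : (forall x, is_derive x (1 : R) g (dg x)) ->
    forall t, is_derive t (1 : R)
      (fun t => al * g ((t - x) / e) - g ((t - y) / e) + be * g ((t - z) / e))
      (e^-1 * (al * dg ((t - x) / e) - dg ((t - y) / e) + be * dg ((t - z) / e))).
  move=> gdg t; apply: (@is_derive_eq _ _ _ _ _ _ _ _ (is_deriveD (is_deriveB
    (is_deriveZ al (dsh g dg x gdg t)) (dsh g dg y gdg t)) (is_deriveZ be (dsh g dg z gdg t)))).
  by rewrite /GRing.scale/=; ring.
have sK : smooth K by move=> n; apply/CnW/CnW; exists K1 => //; exists bump => //; exact: smooth_bump.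
split; last first.
  rewrite derive1Sn derive1n1 (is_derive_derive1 (dcomb _ _ dK)).
  apply/funext => t; rewrite derive1E.
  have d2 := is_deriveZ e^-1 (dcomb _ _ dK1 t).
  by rewrite (@derive_val _ _ _ _ _ _ _ d2) /GRing.scale/= expr2 invfM mulrA.
split.
  apply: smooth_derivable => n.
  have sh (w : R) : Cn n (fun t => K ((t - w) / e)).
    rewrite (_ : (fun _ => _) = (fun t => K (e^-1 * t + (- w / e)))); last first.
      by apply/funext => t; congr K; ring.
    by apply: Cn_comp_affine; exact: sK.
  rewrite (_ : eta = (cst al * (fun t => K ((t - x) / e)) +
    cst (-1) * (fun t => K ((t - y) / e)) + cst be * (fun t => K ((t - z) / e)))); last first.
    by apply/funext => t; rewrite /eta /= !fctE mulN1r.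
  by do !apply: CnD; apply: CnM => //; exact: Cn_cst.
exists x, (z + e); split => // t; apply: contraNT; rewrite negb_and -!ltNge => /orP[tx|tz].
  have neg w : x <= w -> K ((t - w) / e) = 0.
    by move=> xw; apply: (K0 _ _).2; rewrite mulr_le0_ge0 ?invr_ge0 ?ltW// subr_lt0 (lt_le_trans tx).
  by rewrite /eta !neg ?mulr0 ?subrr ?addr0// ltW// (lt_trans xy).
have pos w : w <= z -> K ((t - w) / e) = m * ((t - w) / e - 1) + K 1.
  move=> wz; apply: (Km _ _).2; rewrite ler_pdivlMr// mul1r; lra.
rewrite /eta !pos; [|lra..].
have -> : be = 1 - al by lra.
have -> : y = al * x + (1 - al) * z by rewrite -alxbez; congr (_ + _ * _); lra.
by apply/eqP; field.
Qed.

End smooth_functions.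

(** * Functions with vanishing weak second derivative *)

Section weak_affine.
Variable R : realType.
Local Notation leb := (@lebesgue_measure R).
Implicit Types (h : R -> R) (x y z e : R).

Lemma bump_le_cst : exists C : R, forall t : R, bump t <= C.
Proof.
have c01 : {within `[(0 : R), 1], continuous (@bump R)}.
  by apply: continuous_subspaceT; exact: smooth_bump 0.
have [c _ bc] := EVT_max ler01 c01.
exists (bump c) => t; case: (boolP (0 < t < 1)) => [t01|/bump_eq0 ->].
  by apply: bc; rewrite in_itv/=; case/andP: t01 => /ltW -> /ltW.
exact: bump_ge0.
Qed.

Lemma measurable_bump x e : measurable_fun setT (fun t : R => bump ((t - x) / e)).
Proof.
have mb : measurable_fun setT (@bump R).
  by apply: continuous_measurable_fun; exact: smooth_bump 0.
apply: (measurableT_comp mb); apply: measurable_funM => //.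
by apply: measurable_funB.
Qed.

Lemma bump_shift_eq0 x e t : 0 < e -> t \notin `[x, x + e] -> bump ((t - x) / e) = 0.
Proof.
move=> e0; rewrite in_itv/= negb_and -!ltNge => tx; apply: bump_eq0.
rewrite negb_and -!leNgt.
case/orP: tx => tx; apply/orP; [left|right].
  by rewrite mulr_le0_ge0 ?invr_ge0 ?ltW// subr_lt0.
by rewrite ler_pdivlMr// mul1r; lra.
Qed.

Section monotone_against_bump.
Variable h : R -> R.
Hypothesis hni : {homo h : x y /~ x <= y}.

Lemma measurable_hbump x e (D : set R) : measurable D ->
  measurable_fun D (fun t => h t * bump ((t - x) / e)).
Proof.
move=> mD; apply: measurable_funM.
  by apply: nonincreasing_measurable => // s t; exact: hni.
by apply: measurable_funS (measurable_bump x e).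
Qed.

Lemma integrable_hbump_itv x e : 0 < e ->
  leb.-integrable `[x, x + e] (EFin \o (fun t => h t * bump ((t - x) / e))).
Proof.
move=> e0; apply: measurable_bounded_integrable => //.
- by rewrite /= lebesgue_measure_itv/=; case: ifPn => _; rewrite ?ltry// -EFinB ltry.
- exact: measurable_hbump.
have [C bC] := bump_le_cst.
exists ((`|h x| + `|h (x + e)|) * `|C|); split; first exact: num_real.
move=> M MC t /= /[!in_itv]/= /andP[xt te].
rewrite (le_trans _ (ltW MC))// normrM ler_pM//; last first.

  by rewrite ger0_norm ?bump_ge0// (le_trans (bC _))// ler_norm.
have h1 := hni xt; have h2 := hni te.
have := ler_norm (h x); have := ler_norm (- h (x + e)); rewrite normrN => n1 n2.
have := normr_ge0 (h x); have := normr_ge0 (h (x + e)) => n3 n4.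
by rewrite ler_norml; apply/andP; split; lra.
Qed.

Lemma integrable_hbump x e : 0 < x -> 0 < e ->
  leb.-integrable `]0, +oo[ (EFin \o (fun t => h t * bump ((t - x) / e))).
Proof.
move=> x0 e0.
have E : (EFin \o (fun t => h t * bump ((t - x) / e))) =
    (EFin \o (fun t => h t * bump ((t - x) / e))) \_ `[x, x + e].
  apply/funext => t; rewrite patchE; case: ifPn => //; rewrite notin_setE/= => tn.
  by rewrite bump_shift_eq0 ?mulr0//; exact/negP.
rewrite E; apply/integrable_restrict => //.
apply: integrableS (integrable_hbump_itv x e0) => //.
exact: measurableI.
Qed.

Lemma Rintegral_hbump x e : 0 < x -> 0 < e ->
  \int[leb]_(t in `]0, +oo[) (h t * bump ((t - x) / e)) =
  \int[leb]_(t in `[x, x + e]) (h t * bump ((t - x) / e)).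
Proof.
move=> x0 e0.
have -> : `[x, x + e]%classic = `]0, +oo[ `&` `[x, x + e].
  apply/seteqP; split => t /=; rewrite !in_itv/=; last by case.
  by move=> /andP[xt ->]; rewrite xt (lt_le_trans x0).
rewrite Rintegral_mkcondr; apply: eq_Rintegral => t _.
rewrite patchE; case: ifPn => //; rewrite notin_setE/= => tn.
by rewrite bump_shift_eq0 ?mulr0//; exact/negP.
Qed.

End monotone_against_bump.

Lemma Rintegral_bump (K1 : R -> R) (m x e : R) :
    (forall x, is_derive x (1 : R) K1 (bump x)) -> K1 0 = 0 -> K1 1 = m -> 0 < e ->
  \int[leb]_(t in `[x, x + e]) (bump ((t - x) / e)) = e * m.
Proof.
move=> dK1 K10 K1m e0.
have dF t : is_derive t (1 : R) (fun t => e * K1 ((t - x) / e)) (bump ((t - x) / e)).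
  have lt : is_derive t (1 : R) (fun s => (s - x) / e) e^-1.
    have := is_deriveZ e^-1 (is_deriveB (is_derive_id t (1 : R)) (is_derive_cst x t (1 : R))).
    rewrite subr0 [_ *: 1]mulr1; congr is_derive; apply/funext => s /=.
    by rewrite [RHS]mulrC.
  have dc := is_deriveZ e (@is_derive1_comp _ K1 (fun s => (s - x) / e) t _ _ (dK1 _) lt).
  apply: (@is_derive_eq _ _ _ _ _ _ _ _ dc).
  by rewrite /GRing.scale/= mulrCA divff ?gt_eqF// mulr1.
have cF : continuous (fun t => e * K1 ((t - x) / e)).
  by move=> t; apply: differentiable_continuous; apply/derivable1_diffP; have [] := dF t.
have cb : continuous (fun t : R => bump ((t - x) / e)).
  move=> t; have := Cn_comp_affine e^-1 (- x / e) (@smooth_bump R 0) t.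
  by rewrite (_ : (fun x0 => _) = (fun t => bump ((t - x) / e)))//; apply/funext => s; congr bump; ring.
rewrite /Rintegral (@continuous_FTC2 _ _ (fun t => e * K1 ((t - x) / e))).
- have -> : (x + e - x) / e = 1 by rewrite [x + e]addrC addrK divff// gt_eqF.
  by rewrite -EFinB/= subrr mul0r K10 K1m mulr0 subr0.
- by rewrite ltrDl.
- exact: continuous_subspaceT.
- split => [t _||]; first by have [] := dF t.
  + exact: cvg_at_right_filter (cF x).
  + exact: cvg_at_left_filter (cF _).
- by move=> t _; rewrite derive1E; exact: derive_val.
Qed.

(** The bump carries mass [e * m] on [[x, x + e]], where a nonincreasing [h] stays between its end
    values. No continuity of [h] enters. *)
Lemma hbump_bounds h (K1 : R -> R) (m x e : R) : {homo h : x y /~ x <= y} ->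
    (forall x, is_derive x (1 : R) K1 (bump x)) -> K1 0 = 0 -> K1 1 = m -> 0 < x -> 0 < e ->
  h (x + e) * (e * m) <= \int[leb]_(t in `]0, +oo[) (h t * bump ((t - x) / e)) <=
  h x * (e * m).
Proof.
move=> hni dK1 K10 K1m x0 e0; rewrite Rintegral_hbump//.
have ib (c : R) : leb.-integrable `[x, x + e] (EFin \o (fun t => c * bump ((t - x) / e))).
  by apply: (@integrable_hbump_itv (cst c)) => //= t s _.
have ib1 : leb.-integrable `[x, x + e] (EFin \o (fun t => bump ((t - x) / e))).
  by have := ib 1; congr integrable; apply/funext => t /=; rewrite mul1r.
rewrite -(Rintegral_bump x dK1 K10 K1m e0) -!RintegralZl//.
apply/andP; split; apply: le_Rintegral => //; try exact: ib; try exact: integrable_hbump_itv.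
  by move=> t /= /[!in_itv]/= /andP[_ te]; rewrite ler_wpM2r ?bump_ge0// hni.
by move=> t /= /[!in_itv]/= /andP[te _]; rewrite ler_wpM2r ?bump_ge0// hni.
Qed.

(** The bump integrals [J] satisfy [J y = al * J x + be * J z] exactly; replacing each of them by a
    value of [h] costs a shift by at most [e]. *)
Lemma weak_affine_ineq h : {homo h : x y /~ x <= y} ->
    (forall eta, test_function eta ->
      \int[leb]_(t in `]0, +oo[) (h t * derive1n 2 eta t) = 0) ->
    forall x y z e al be, 0 < x -> x < y -> y < z -> 0 < e -> 0 <= al -> 0 <= be ->
      al + be = 1 -> al * x + be * z = y ->
    al * h (x + e) + be * h (z + e) <= h y /\ h (y + e) <= al * h x + be * h z.
Proof.
move=> hni hw x y z e al be x0 xy yz e0 al0 be0 albe alxbez.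
have [K1 [K [m [m0 dK1 dK K0 Km]]]] := bump_primitives R.
have [tf d2] := test_function_kernel dK1 dK K0 Km x0 e0 xy yz albe alxbez.
have y0 : 0 < y := lt_trans x0 xy; have z0 : 0 < z := lt_trans y0 yz.
have := hw _ tf; rewrite {}d2.
pose J x := \int[leb]_(t in `]0, +oo[) (h t * bump ((t - x) / e)).
have iJ w : 0 < w -> leb.-integrable `]0, +oo[ (EFin \o (fun t => h t * bump ((t - w) / e))).
  by move=> w0; exact: integrable_hbump.
have iZ (c w : R) : 0 < w -> leb.-integrable `]0, +oo[ (EFin \o (fun t => c * (h t * bump ((t - w) / e)))).
  by move=> w0; exact: (integrableZl _ c (iJ w w0)).
have -> : (fun t => h t * (e ^- 2 *
      (al * bump ((t - x) / e) - bump ((t - y) / e) + be * bump ((t - z) / e)))) =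
    (fun t => e ^- 2 * (al * (h t * bump ((t - x) / e)) - h t * bump ((t - y) / e) +
      be * (h t * bump ((t - z) / e)))).
  by apply/funext => t; ring.
have iB : leb.-integrable `]0, +oo[ (EFin \o (fun t => al * (h t * bump ((t - x) / e))
   - h t * bump ((t - y) / e))).
  by apply: (integrableB _ (iZ al x x0) (iJ y y0)).
rewrite RintegralZl//; last by apply: (integrableD _ iB (iZ be z z0)).
rewrite RintegralD//; last exact: iZ.
rewrite RintegralB//; [|exact: iZ|exact: iJ].
rewrite !RintegralZl//; [|exact: iJ..].
rewrite -!/(J _) => /eqP; rewrite mulf_eq0 invr_eq0 expf_eq0/= gt_eqF//= => /eqP J0.
have em0 : 0 < e * m by rewrite mulr_gt0.
have K10 := (K0 0 (lexx _)).1; have K11 := (Km 1 (lexx _)).1.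
have bd w (w0 : 0 < w) := hbump_bounds hni dK1 K10 K11 w0 e0.
have /andP[x1 x2] := bd x x0; have /andP[y1 y2] := bd y y0; have /andP[z1 z2] := bd z z0.
rewrite -!/(J _) in x1 x2 y1 y2 z1 z2.
have JE : J y = al * J x + be * J z by apply/eqP; rewrite eq_sym -subr_eq0 addrAC J0.
split; rewrite -(ler_pM2r em0).
  apply: (le_trans _ y2); rewrite JE mulrDl -!mulrA.
  by apply: lerD; apply: ler_wpM2l; [exact: al0|exact: x1|exact: be0|exact: z1].
apply: (le_trans y1); rewrite JE mulrDl -!mulrA.
by apply: lerD; apply: ler_wpM2l; [exact: al0|exact: x2|exact: be0|exact: z2].
Qed.

(** Since [h] might jump, the shifts by [e] cannot be removed by letting [e] tend to 0. The right
    limit [hp] absorbs them and satisfies the exact affine relation; [h] is then squeezed between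
    [hp x] and [hp (x - d)], and these come together because [hp] is affine. *)
Lemma affine_of_ineq h : {homo h : x y /~ x <= y} ->
    (forall x y z e al be, 0 < x -> x < y -> y < z -> 0 < e -> 0 <= al -> 0 <= be ->
      al + be = 1 -> al * x + be * z = y ->
    al * h (x + e) + be * h (z + e) <= h y /\ h (y + e) <= al * h x + be * h z) ->
  exists p q, forall x, 0 < x -> h x = p + q * x.
Proof.
move=> hni hineq.
pose hp x := sup [set h t | t in [set t | x < t]].
have hs x : has_sup [set h t | t in [set t | x < t]].
  split; first by exists (h (x + 1)), (x + 1) => //=; rewrite ltrDl.
  by exists (h x) => _ [t /= /ltW xt <-]; exact: hni.
have hpub x t : x < t -> h t <= hp x.
  by move=> xt; apply: sup_upper_bound => //; exists t.
have hple x M : (forall t, x < t -> h t <= M) -> hp x <= M.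
  move=> hM; apply: ge_sup; first by case: (hs x).
  by move=> _ [t /= xt <-]; exact: hM.
have hpaff x y z : 0 < x -> x < y -> y < z ->
    (z - x) * hp y = (z - y) * hp x + (y - x) * hp z.
  move=> x0 xy yz; have zx0 : 0 < z - x by lra.
  pose al := (z - y) / (z - x); pose be := (y - x) / (z - x).
  have al0 : 0 < al by rewrite divr_gt0//; lra.
  have be0 : 0 < be by rewrite divr_gt0//; lra.
  have albe : al + be = 1.
    by rewrite -mulrDl (_ : z - y + _ = z - x) ?divff ?gt_eqF//; ring.
  have aldelta d : al * (x + d) + be * (z + d) = y + d.
    by rewrite /al /be; field; rewrite gt_eqF.
  suff hpy : hp y = al * hp x + be * hp z.
    by rewrite hpy /al /be; field; rewrite gt_eqF.
  apply/eqP; rewrite eq_le; apply/andP; split.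
    (* One [d] translates the triple, so that [x] and [z] are passed strictly, and the other is the
       width of the bump. *)
    apply: hple => t yt; pose d := (t - y) / 2.
    have d0 : 0 < d by rewrite /d; lra.
    have -> : t = (y + d) + d by rewrite /d; field.
    have xd0 : 0 < x + d by lra.
    have xyd : x + d < y + d by lra.
    have yzd : y + d < z + d by lra.
    apply: le_trans (hineq _ _ _ d _ _ xd0 xyd yzd d0 (ltW al0) (ltW be0) albe (aldelta d)).2 _.
    by apply: lerD; (apply: ler_wpM2l; [exact: ltW|apply: hpub; lra]).
  have step s u : x < s -> z < u -> al * h s + be * h u <= hp y.
    (* Two steps of length [d] from [x] and from [z] stay below [s] and [u]. *)
    move=> xs zu; pose d := Num.min (s - x) (u - z) / 2.
    have m0 : 0 < Num.min (s - x) (u - z) by rewrite lt_min !subr_gt0 xs.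
    have d0 : 0 < d by rewrite divr_gt0.
    have dd : d + d = Num.min (s - x) (u - z) by rewrite /d; field.
    have ds : d + d <= s - x by rewrite dd ge_min lexx.
    have du : d + d <= u - z by rewrite dd ge_min lexx orbT.
    have xd0 : 0 < x + d by lra.
    have xyd : x + d < y + d by lra.
    have yzd : y + d < z + d by lra.
    have := (hineq _ _ _ d _ _ xd0 xyd yzd d0 (ltW al0) (ltW be0) albe (aldelta d)).1.
    have : h (y + d) <= hp y by apply: hpub; lra.
    have h1 : al * h s <= al * h (x + d + d) by apply: ler_wpM2l; [exact: ltW|apply: hni; lra].
    have h2 : be * h u <= be * h (z + d + d) by apply: ler_wpM2l; [exact: ltW|apply: hni; lra].
    lra.
  have step2 u : z < u -> al * hp x + be * h u <= hp y.
    move=> zu; rewrite -lerBrDr -ler_pdivlMl//; apply: hple => s xs.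
    by rewrite ler_pdivlMl// lerBrDr; exact: step.
  by rewrite -lerBrDl -ler_pdivlMl//; apply: hple => u zu; rewrite ler_pdivlMl// lerBrDl; exact: step2.
pose q := hp 2 - hp 1; pose p := hp 1 - q.
have hpE x : 0 < x -> hp x = p + q * x.
  move=> x0; rewrite /p /q.
  have [x1|x1|->] := ltgtP x 1; last by lra.
    have := hpaff x 1 2 x0 x1 ltac:(lra); lra.
  have [x2|x2|->] := ltgtP x 2; last by lra.
    have := hpaff 1 x 2 ltr01 x1 x2; lra.
  have := hpaff 1 2 x ltr01 ltac:(lra) x2; lra.
exists p, q => x x0; apply/eqP; rewrite eq_le; apply/andP; split; last first.
  by rewrite -hpE//; apply: hple => t /ltW; exact: hni.
apply/ler_addgt0Pr => e e0.
(* The first bound keeps [x - d] positive, the second keeps the variation [|q| d] of the affine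
   function below [e]. *)
pose d := Num.min (x / 2) (e / (`|q| + 1)).
have q1 : 0 < `|q| + 1 by rewrite ltr_wpDl.
have d0 : 0 < d by rewrite lt_min !divr_gt0.
have dx : d <= x / 2 by rewrite ge_min lexx.
have de : d * (`|q| + 1) <= e by rewrite -ler_pdivlMr// ge_min lexx orbT.
have xd : x - d < x by lra.
apply: le_trans (hpub _ _ xd) _; rewrite hpE; last by lra.
have : - q * d <= `|q| * d.
  by apply: ler_wpM2r; [exact: ltW|rewrite -normrN ler_norm].
lra.
Qed.

End weak_affine.

(** * Regularity of solutions of the string equation *)

Section Rintegral_complements.
Context d1 d2 (T1 : measurableType d1) (T2 : measurableType d2) (R : realType).
Variable m1 : {sigma_finite_measure set T1 -> \bar R}.
Variable m2 : {sigma_finite_measure set T2 -> \bar R}.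

(** The inner real integral is the [fine] of the extended one, and the two agree wherever the
    section is integrable, that is, almost everywhere. *)
Lemma Rintegral_fubini_Fubini (f : T1 * T2 -> R) :
  (m1 \x m2)%E.-integrable setT (EFin \o f) ->
  \int[m1]_x (\int[m2]_y f (x, y)) = fine (\int[m1]_x \int[m2]_y (f (x, y))%:E)%E.
Proof.
move=> fi; congr fine.
have mF := measurable_fubini_F fi.
apply: ae_eq_integral => //.
  apply/measurable_EFinP; exact: (measurableT_comp (fine_measurable measurableT)).
have := ae_integrable1 fi; apply: filterS => x ix _.
by rewrite fineK//; exact: integrable_fin_num.
Qed.

End Rintegral_complements.

Lemma Rintegral_fubini d1 d2 (T1 : measurableType d1) (T2 : measurableType d2)
    (R : realType) (m1 : {sigma_finite_measure set T1 -> \bar R})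
    (m2 : {sigma_finite_measure set T2 -> \bar R}) (f : T1 * T2 -> R) :
  (m1 \x m2)%E.-integrable setT (EFin \o f) ->
  \int[m1]_x (\int[m2]_y f (x, y)) = \int[m2]_y (\int[m1]_x f (x, y)).
Proof.
move=> fi; rewrite Rintegral_fubini_Fubini// (Fubini fi).
congr fine; apply: ae_eq_integral => //.
- exact: measurable_fubini_G fi.
- apply/measurable_EFinP; apply: (measurableT_comp (fine_measurable measurableT)).
  exact: measurable_fubini_G fi.
- have := ae_integrable2 fi; apply: filterS => x ix _.
  by rewrite fineK//; exact: integrable_fin_num.
Qed.

Lemma eq_Rintegral_supp d (T : measurableType d) (R : realType)
    (mu : {measure set T -> \bar R}) (A B : set T) (f : T -> R) :
  (forall x, f x != 0 -> A x <-> B x) -> \int[mu]_(x in A) f x = \int[mu]_(x in B) f x.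
Proof.
move=> AB; rewrite Rintegral_mkcond [RHS]Rintegral_mkcond; congr fine.
apply: eq_integral => x _; congr EFin; rewrite !patchE.
have [fx0|/AB ABx] := eqVneq (f x) 0; first by rewrite fx0; do 2 case: ifP.
by rewrite (_ : (x \in A) = (x \in B))//; apply/idP/idP; rewrite !inE => /ABx.
Qed.

Lemma integrable_prod_mul d1 d2 (T1 : measurableType d1) (T2 : measurableType d2)
    (R : realType) (m1 : {sigma_finite_measure set T1 -> \bar R})
    (m2 : {sigma_finite_measure set T2 -> \bar R}) (f1 : T1 -> R) (f2 : T2 -> R) :
  m1.-integrable setT (EFin \o f1) -> m2.-integrable setT (EFin \o f2) ->
  (m1 \x m2)%E.-integrable setT (EFin \o (fun p => f1 p.1 * f2 p.2)).
Proof.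
move=> i1 i2.
have /integrableP[/measurable_EFinP mf1 _] := i1.
have /integrableP[/measurable_EFinP mf2 f2y] := i2.
apply/integrable12ltyP.
  apply/measurable_EFinP; apply: measurable_funM.
    exact: (measurableT_comp mf1).
  exact: (measurableT_comp mf2).
have fi2 : (\int[m2]_y `|(f2 y)%:E| \is a fin_num)%E.
  by rewrite ge0_fin_numE// integral_ge0.
rewrite (_ : (fun x => _) = (fun x => (fine (\int[m2]_y `|(f2 y)%:E|))%:E * `|(f1 x)%:E|)%E); last first.
  apply/funext => x; rewrite fineK//.
  under eq_integral do rewrite /= normrM EFinM.
  rewrite ge0_integralZl//; first by rewrite muleC.
  by apply/measurable_EFinP; apply: measurableT_comp.
have := integrableZl measurableT (fine (\int[m2]_y `|(f2 y)%:E|)%E) (integrable_abse i1).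
move=> /integrableP[_]; apply: le_lt_trans; apply: ge0_le_integral => //.
- by move=> x _; rewrite mule_ge0// lee_fin fine_ge0// integral_ge0.
- by apply: emeasurable_funM => //; do 2 apply: measurableT_comp => //.
- by do !apply: measurableT_comp => //; apply: emeasurable_funM => //; do 2 apply: measurableT_comp => //.
- by move=> x _; exact: lee_abs.
Qed.

(** * Derivatives and supports of test functions *)

Section test_function_theory.
Variable R : realType.
Implicit Types (eta : R -> R) (x : R).

Lemma test_function_is_derive eta n x : test_function eta ->
  is_derive x (1 : R) (derive1n n eta) (derive1n n.+1 eta x).
Proof.
move=> [dtf _]; apply: DeriveDef; first exact: dtf.
by rewrite derive1nS derive1E.
Qed.

Lemma test_function_continuous eta n : test_function eta -> continuous (derive1n n eta).
Proof.
move=> te x; apply: differentiable_continuous; apply/derivable1_diffP.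
by have [] := test_function_is_derive n x te.
Qed.

Lemma test_function_supp eta : test_function eta ->
  exists a b, [/\ 0 < a, a < b & forall n x, ~~ (a <= x <= b) -> derive1n n eta x = 0].
Proof.
(* The definition allows [b <= a], for instance for the zero function; the maximum forces a proper
   interval. *)
move=> [_ [a [b [a0 ab]]]]; exists a, (Num.max b (a + 1)); split => //.
  by rewrite lt_max ltrDl ltr01 orbT.
set b' := Num.max _ _.
have out x : ~~ (a <= x <= b') -> eta x = 0.
  move=> xab; apply/eqP; apply: contraNT xab => /ab /andP[-> xb].
  by rewrite /b' le_max xb.
elim => [|n IH] x; first exact: out.
rewrite negb_and -!ltNge => xab; rewrite derive1nS derive1E.
have -> : 0 = 'D_1 (cst (0 : R)) x by rewrite derive_cst.
apply: near_eq_derive.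
case/orP: xab => xab; near=> y; rewrite IH// negb_and -!ltNge; apply/orP; [left|right]; near: y.
  exact: lt_nbhsl.
exact: lt_nbhsr.
Unshelve. all: end_near. Qed.

End test_function_theory.

(** * First and second primitives of a locally integrable function *)

Section second_primitive.
Variables (R : realType) (w : R -> R).
Local Notation leb := (@lebesgue_measure R).
Hypothesis w0 : forall x, 0 <= w x.
Hypothesis wi : forall b, 0 <= b -> leb.-integrable `[0, b] (EFin \o w).

Definition prim1 (z : R) := \int[leb]_(t in `[0, z]) w t.

Lemma prim1_le0 z : z <= 0 -> prim1 z = 0.
Proof.
rewrite le_eqVlt => /predU1P[->|z0]; first by rewrite /prim1 set_itv1 Rintegral_set1.
by rewrite /prim1 set_itv_ge ?Rintegral_set0// bnd_simp -ltNge.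
Qed.

Lemma prim1B x y : 0 <= x -> x <= y -> prim1 y - prim1 x = \int[leb]_(t in `]x, y]) w t.
Proof.
move=> x0 xy; rewrite /prim1 Rintegral_itvB ?bnd_simp//.
by apply: wi; exact: le_trans xy.
Qed.

Lemma prim1_ge0 z : 0 <= prim1 z.
Proof. by apply: Rintegral_ge0 => t _; exact: w0. Qed.

Lemma prim1_nd : {homo prim1 : x y / x <= y}.
Proof.
move=> x y xy; have [x0|x0] := leP 0 x; last by rewrite prim1_le0 ?prim1_ge0// ltW.
by rewrite -subr_ge0 prim1B//; apply: Rintegral_ge0 => t _; exact: w0.
Qed.

Lemma prim1_continuous : continuous prim1.
Proof.
move=> z; have [z0|z0|->] := ltgtP z 0.
- rewrite /continuous_at [prim1 z]prim1_le0 ?ltW//; apply: cvg_near_cst.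
  by near=> y; rewrite prim1_le0//; apply/ltW; near: y; exact: lt_nbhsl.
- have z1 : 0 < z + 1 by rewrite addr_gt0.
  have := parameterized_integral_continuous (ltW z1) (wi (ltW z1)).
  move=> /(continuous_within_itvP _ z1)[+ _ _]; apply.
  by rewrite in_itv/=; apply/andP; split => //; rewrite ltrDl ltr01.
- rewrite /continuous_at [prim1 0]prim1_le0//.
  exact: (parameterized_integral_cvg_left ltr01 (wi ler01)).
Unshelve. all: end_near. Qed.

Lemma Rintegral_prim1_deriv eta (M : R) : 0 < M -> test_function eta ->
    (forall n x, ~~ (0 < x < M) -> derive1n n eta x = 0) ->
  \int[leb]_(z in `[0, M]) (prim1 z * derive1n 1 eta z) =
  - \int[leb]_(t in `[0, M]) (w t * eta t).
Proof.
move=> M0 te out.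
pose E := [set p : R * R | p.2 <= p.1].
pose f (p : R * R) := ((derive1n 1 eta) \_ `[0, M]) p.1 * (w \_ `[0, M]) p.2 * \1_E p.
have ce' := @test_function_continuous _ eta 1 te.
have iw : leb.-integrable setT (EFin \o (w \_ `[0, M])).
  rewrite -restrict_EFin; apply/integrable_restrict => //; rewrite setTI.
  by apply: wi; exact: ltW.
have ie : leb.-integrable setT (EFin \o ((derive1n 1 eta) \_ `[0, M])).
  rewrite -restrict_EFin; apply/integrable_restrict => //; rewrite setTI.
  apply: continuous_compact_integrable; first exact: segment_compact.
  exact: continuous_subspaceT.
have E1 z t : \1_E (z, t) = (t <= z)%R%:R :> R.
  by rewrite indicE; congr (_%:R); congr nat_of_bool; apply/idP/idP; rewrite inE.
have mE : measurable (E : set (measurableTypeR R * measurableTypeR R)).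
  have ml := @measurable_fun_ler _ (measurableTypeR R * measurableTypeR R)%type R setT
    snd fst measurable_snd measurable_fst measurableT [set true] I.
  by move: ml; rewrite setTI; congr measurable.
have fi : (leb \x leb)%E.-integrable setT (EFin \o f).
  apply: (integrableMl _ (integrable_prod_mul ie iw)) => //.
  exists 1; split => // M' M1 p _ /=; rewrite (le_trans _ (ltW M1))//.
  by rewrite indicE; case: (_ \in _); rewrite ?normr1 ?normr0.
have := Rintegral_fubini fi.
have -> : \int[leb]_x (\int[leb]_y f (x, y)) = \int[leb]_(z in `[0, M]) (prim1 z * derive1n 1 eta z).
  rewrite [RHS]Rintegral_mkcond; apply: eq_Rintegral => z _.
  rewrite /f/= !patchE; case: ifPn => [zD|_]; last first.
    by rewrite (@eq_Rintegral _ _ _ _ _ (cst 0)) ?Rintegral_cst ?mul0r// => t _; rewrite !mul0r.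
  move: zD; rewrite inE/= in_itv/= => /andP[z0 zM].
  have iz : leb.-integrable setT (EFin \o (w \_ `[0, z])).
    rewrite -restrict_EFin; apply/integrable_restrict => //.
    by rewrite setTI; exact: wi.
  rewrite mulrC /prim1 Rintegral_mkcond -RintegralZl//; apply: eq_Rintegral => t _.
  rewrite -mulrA; congr (_ * _). rewrite E1 !patchE !mem_setE !in_itv/=.
  have [t0|_] /= := boolP (0 <= t); last by rewrite mul0r.
  have [tz|_] /= := boolP (t <= z); last by rewrite mulr0.
  by rewrite (le_trans tz zM) mulr1.
have -> : \int[leb]_y (\int[leb]_x f (x, y)) = \int[leb]_(t in `[0, M]) (- (w t * eta t)).
  rewrite [RHS]Rintegral_mkcond; apply: eq_Rintegral => t _.
  rewrite /f/= !patchE; case: ifPn => [tD|_]; last first.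
    by rewrite (@eq_Rintegral _ _ _ _ _ (cst 0)) ?Rintegral_cst ?mul0r// => z _; rewrite mulr0 mul0r.
  move: tD; rewrite inE/= in_itv/= => /andP[t0 tM].
  have it : leb.-integrable setT (EFin \o ((derive1n 1 eta) \_ `[t, M])).
    rewrite -restrict_EFin; apply/integrable_restrict => //.
    rewrite setTI; apply: continuous_compact_integrable; first exact: segment_compact.
    exact: continuous_subspaceT.
  transitivity (w t * \int[leb]_(z in `[t, M]) derive1n 1 eta z).
    rewrite Rintegral_mkcond -RintegralZl//; apply: eq_Rintegral => z _.
    rewrite [_ * w t]mulrC -mulrA; congr (_ * _); rewrite E1 !patchE !mem_setE !in_itv/=.
    have [zM|_] /= := boolP (z <= M); last by rewrite !andbF mul0r.
    have [tz|_] /= := boolP (t <= z); last by rewrite mulr0.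
    by rewrite (le_trans t0 tz) mulr1.
  rewrite -mulrN; congr (_ * _).
  have etaM : eta M = 0 by apply: (out 0%N); rewrite ltxx andbF.
  move: tM; rewrite le_eqVlt => /predU1P[->|tM]; first by rewrite set_itv1 Rintegral_set1 etaM oppr0.
  rewrite /Rintegral (@continuous_FTC2 _ _ eta)//.
  - by rewrite -EFinB/= etaM sub0r.
  - exact: continuous_subspaceT.
  - have ce := @test_function_continuous _ eta 0 te.
    split => [x _||]; first by have [] := test_function_is_derive 0 x te.
      exact: cvg_at_right_filter (ce _).
    exact: cvg_at_left_filter (ce _).
move=> ->; rewrite (_ : (fun t => - (w t * eta t)) = (fun t => -1 * (w t * eta t))); last first.
  by apply/funext => t; rewrite mulN1r.
rewrite RintegralZl ?mulN1r//.
have [C etaC] : exists C, forall t, t \in `[0, M] -> `|eta t| <= C.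
  have cn : {within `[0, M], continuous (fun t => `|eta t|)}.
    apply: continuous_subspaceT => t; apply: cvg_norm.
    exact: (@test_function_continuous _ eta 0 te).
  by have [c _ cE] := EVT_max (ltW M0) cn; exists `|eta c|.
apply: (integrableMl _ (wi (ltW M0))) => //.
  apply: measurable_funTS; apply: continuous_measurable_fun.
  exact: (@test_function_continuous _ eta 0 te).
exists C; split; first exact: num_real.
by move=> K CK t Dt /=; rewrite (le_trans _ (ltW CK))// etaC.
Qed.

End second_primitive.

Section second_primitive_weak.
Variable R : realType.
Local Notation leb := (@lebesgue_measure R).

Lemma integrable_mul_test (g eta : R -> R) n : test_function eta ->
    (forall b, 0 <= b -> leb.-integrable `[0, b] (EFin \o g)) ->
  leb.-integrable `]0, +oo[ (EFin \o (fun t => g t * derive1n n eta t)).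
Proof.
move=> te gi; have [a [b [a0 ab out]]] := test_function_supp te.
have b0 : 0 <= b by rewrite ltW// (lt_trans a0).
have E : (EFin \o (fun t => g t * derive1n n eta t)) =
    (EFin \o (fun t => g t * derive1n n eta t)) \_ `[a, b].
  apply/funext => t; rewrite patchE mem_setE in_itv/=; case: ifPn => // /out out0.
  by rewrite /= out0 mulr0.
rewrite E; apply/integrable_restrict => //.
have ce := @test_function_continuous _ eta n te.
have cn : {within `[0, b], continuous (fun t => `|derive1n n eta t|)}.
  by apply: continuous_subspaceT => t; apply: cvg_norm; exact: ce.
have [c _ cE] := EVT_max b0 cn.
have : leb.-integrable `[0, b] (EFin \o (fun t => g t * derive1n n eta t)).
  apply: (integrableMl _ (gi _ b0)) => //.
    by apply: measurable_funTS; exact: continuous_measurable_fun.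
  exists `|derive1n n eta c|; split; first exact: num_real.
  by move=> K CK t Dt /=; rewrite (le_trans _ (ltW CK))// cE.
apply: integrableS => //; first exact: measurableI.
move=> t [_ /=]; rewrite !in_itv/= => /andP[at_ ->]; rewrite andbT.
by rewrite ltW// (lt_le_trans a0).
Qed.

Lemma continuous_integrable_itv (g : R -> R) (b : R) : continuous g ->
  leb.-integrable `[0, b] (EFin \o g).
Proof.
move=> cg; apply: continuous_compact_integrable; first exact: segment_compact.
exact: continuous_subspaceT.
Qed.

Variable w : R -> R.
Hypothesis wi : forall b, 0 <= b -> leb.-integrable `[0, b] (EFin \o w).

(** Two integrations by parts: a classical one, because [W] has the continuous derivative [prim1 w],
    and then [Rintegral_prim1_deriv]. *)
Lemma weak_prim2 : exists W : R -> R,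
  [/\ (forall x, is_derive x (1 : R) W (prim1 w x)), (forall x, x <= 0 -> W x = 0) &
   forall eta, test_function eta ->
    \int[leb]_(t in `]0, +oo[) (W t * derive1n 2 eta t) =
    \int[leb]_(t in `]0, +oo[) (w t * eta t)].
Proof.
have [W dW W0] := primitive_from0 (prim1_continuous wi) (@prim1_le0 _ w).
exists W; split => // eta te.
have [a [b [a0 ab out]]] := test_function_supp te.
pose M := b + 1; have M0 : 0 < M by rewrite /M addr_gt0// (lt_trans a0).
have bM : b < M by rewrite ltrDl.
have outM n x : ~~ (0 < x < M) -> derive1n n eta x = 0.
  move=> xM; apply: out; apply: contraNN xM => /andP[ax xb].
  by rewrite (lt_le_trans a0 ax) (le_lt_trans xb bM).
have supp (g : R -> R) n : \int[leb]_(t in `]0, +oo[) (g t * derive1n n eta t) =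
    \int[leb]_(t in `[0, M]) (g t * derive1n n eta t).
  apply: eq_Rintegral_supp => x; rewrite mulf_eq0 negb_or => /andP[_ ex].
  have /andP[x0 xM] : 0 < x < M by apply: contraNT ex => /outM ->.
  by rewrite /= !in_itv/= x0 ltW// ltW.
rewrite supp (supp _ 0%N) derive1n0.
have cW : continuous W.
  by move=> t; apply: differentiable_continuous; apply/derivable1_diffP; have [] := dW t.
have ce n := @test_function_continuous _ eta n te.
rewrite (@Rintegration_by_parts _ W (derive1n 1 eta) (prim1 w) (derive1n 2 eta))//.
- rewrite !(outM 1%N) ?ltxx ?andbF// !mulr0 subrr sub0r.
  by rewrite (Rintegral_prim1_deriv wi M0 te outM) opprK.
- by apply: continuous_subspaceT; exact: prim1_continuous.
- split => [x _||]; first by have [] := dW x.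
    exact: cvg_at_right_filter (cW _).
  exact: cvg_at_left_filter (cW _).
- by move=> x _; rewrite derive1E; exact: derive_val.
- exact: continuous_subspaceT.
- split => [x _||]; first by have [] := test_function_is_derive 1 x te.
    exact: cvg_at_right_filter (ce 1%N _).
  exact: cvg_at_left_filter (ce 1%N _).
Qed.

End second_primitive_weak.

(** * Integral representation of a solution *)

Section krein_regularity.
Variables (R : realType) (A : R -> R) (a : R) (r : R -> R).
Local Notation leb := (@lebesgue_measure R).
Hypothesis hA : krein_string A.
Hypothesis a0 : 0 <= a.
Hypothesis hr : krein_solution A a r.

Lemma krein_solution_bounds z : 0 <= z -> 0 <= r z <= 1.
Proof.
move=> z0; have [rni _ [r0 _] [l rl l0]] := hr.
apply/andP; split; last by rewrite -r0; apply: rni; rewrite ?in_itv/= ?lexx// z0.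
apply: le_trans l0 _; apply: (cvgr_to_le rl).
near=> t; have zt : z <= t by near: t; apply: nbhs_pinfty_ge; exact: num_real.
by apply: rni => //; rewrite in_itv/= andbT// (le_trans z0).
Unshelve. all: end_near. Qed.

(** Cut off because the sign of [A] and [r] is known only on the half line, whereas the results on
    primitives ask for a sign everywhere. *)
Definition krein_rhs : R -> R := (fun t => a * A t * r t) \_ `[0, +oo[.

(** Freezing [r] at its value in 0 makes it nonincreasing on the whole line, as the bump estimates
    require. *)
Let rt (t : R) := r (Num.max t 0).

Let rt_ni : {homo rt : x y /~ x <= y}.
Proof.
move=> x y xy; have [rni _ _ _] := hr; apply: rni.
- by rewrite in_itv/= le_max lexx orbT.
- by rewrite in_itv/= le_max lexx orbT.
- by rewrite ge_max le_max xy/= le_max lexx orbT.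
Qed.

Let rtE t : 0 <= t -> rt t = r t.
Proof. by move=> t0; rewrite /rt max_l. Qed.

Let mrt (D : set R) : measurable D -> measurable_fun D rt.
Proof. by move=> mD; apply: nonincreasing_measurable => // s t; exact: rt_ni. Qed.

Lemma krein_rhs_ge0 t : 0 <= krein_rhs t.
Proof.
rewrite /krein_rhs patchE mem_setE in_itv/= andbT; case: ifPn => // t0.
by rewrite !mulr_ge0//; [exact: hA.1|case/andP: (krein_solution_bounds t0)].
Qed.

Lemma krein_rhs_integrable b : 0 <= b -> leb.-integrable `[0, b] (EFin \o krein_rhs).
Proof.
move=> b0; have iA := hA.2 b b0.
have ir : leb.-integrable `[0, b] (EFin \o (fun t => a * (A t * rt t))).
  suff : leb.-integrable `[0, b] (EFin \o (fun t => A t * rt t)).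
    by move=> iAr; exact: (integrableZl _ a iAr).
  apply: (integrableMl _ iA) => //; first exact: mrt.
  exists 1; split => // M M1 t /=; rewrite in_itv/= => /andP[t0 _].
  rewrite rtE// (le_trans _ (ltW M1))//.
  by have /andP[r0 r1] := krein_solution_bounds t0; rewrite ger0_norm.
apply: eq_integrable ir => // t; rewrite inE/= in_itv/= => /andP[t0 _].
by rewrite /krein_rhs patchE mem_setE in_itv/= t0/= rtE// mulrA.
Qed.

(** [W] is nondecreasing because the right-hand side is nonnegative, so [r - W] is still
    nonincreasing and [affine_of_ineq] applies to it. The intercept comes from the limit of [r] at
    0+; the weak equation does not see [r 0]. *)
Lemma krein_regular : exists q (W : R -> R),
  [/\ (forall z, 0 <= z -> r z = 1 + q * z + W z),
      (forall x, is_derive x (1 : R) W (prim1 krein_rhs x)) &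
      (forall x, x <= 0 -> W x = 0)].
Proof.
have [W [dW W0 wW]] := weak_prim2 krein_rhs_integrable.
have [rni [_ _ wr] [r0 r0cvg] _] := hr.
have cW : continuous W.
  by move=> t; apply: differentiable_continuous; apply/derivable1_diffP; have [] := dW t.
have Wnd x y : x <= y -> W x <= W y.
  rewrite le_eqVlt => /predU1P[->//|xy].
  have [c _ Wc] := MVT xy (fun t _ => dW t) (continuous_subspaceT cW).
  by rewrite -subr_ge0 Wc mulr_ge0 ?subr_ge0 ?(ltW xy)// prim1_ge0//; exact: krein_rhs_ge0.
pose h t := rt t - W t.
have hni : {homo h : x y /~ x <= y}.
  by move=> x y xy; rewrite /h lerB ?rt_ni// Wnd.
have rti b : 0 <= b -> leb.-integrable `[0, b] (EFin \o rt).
  move=> b0; apply: measurable_bounded_integrable => //.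
  - by rewrite /= lebesgue_measure_itv/=; case: ifPn => _; rewrite ?ltry// -EFinB ltry.
  - exact: mrt.
  exists 1; split => // M M1 t /=; rewrite in_itv/= => /andP[t0 _].
  rewrite rtE// (le_trans _ (ltW M1))//.
  by have /andP[? ?] := krein_solution_bounds t0; rewrite ger0_norm.
have hw eta : test_function eta -> \int[leb]_(t in `]0, +oo[) (h t * derive1n 2 eta t) = 0.
  move=> te.
  have -> : (fun t => h t * derive1n 2 eta t) = (fun t => rt t * derive1n 2 eta t - W t * derive1n 2 eta t).
    by apply/funext => t; rewrite mulrBl.
  rewrite RintegralB//; last 2 first.
    exact: integrable_mul_test.
    by apply: integrable_mul_test => // b b0; exact: continuous_integrable_itv.
  rewrite wW//; apply/eqP; rewrite subr_eq0; apply/eqP.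
  transitivity (\int[leb]_(t in `]0, +oo[) (r t * derive1n 2 eta t)).
    by apply: eq_Rintegral => t; rewrite inE/= in_itv/= andbT => /ltW t0; rewrite rtE.
  rewrite wr//; apply: eq_Rintegral => t; rewrite inE/= in_itv/= andbT => t0.
  by rewrite /krein_rhs patchE mem_setE in_itv/= ltW.
have [p [q hpq]] := affine_of_ineq hni (weak_affine_ineq hni hw).
have rE z : 0 < z -> r z = p + q * z + W z.
  by move=> z0; rewrite -hpq// /h rtE ?ltW// subrK.
have p1 : p = 1.
  have c1 : r z @[z --> 0^'+] --> p + q * 0 + W 0.
    have c2 : p + q * z + W z @[z --> 0^'+] --> p + q * 0 + W 0.
      apply: cvg_at_right_filter; apply: cvgD; last exact: cW.
      by apply: cvgD; [exact: cvg_cst|apply: cvgM; [exact: cvg_cst|exact: cvg_id]].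
    apply: cvg_trans c2; apply: near_eq_cvg; near=> z; rewrite rE//.
  have := cvg_unique _ c1 r0cvg; rewrite mulr0 W0// !addr0; exact.
exists q, W; split => // z; rewrite le_eqVlt => /predU1P[<-|z0].
  by rewrite r0 mulr0 W0// !addr0.
by rewrite rE// p1.
Unshelve. all: end_near. Qed.

End krein_regularity.

(** * Dependence on the spectral parameter *)

Section sign_changes.
Variable R : realType.

(** The supremum of the points of [[x, y]] where [g] is nonpositive; continuity excludes a positive
    value there. *)
Lemma last_nonpositive (g : R -> R) (x y : R) : continuous g -> x <= y ->
  g x <= 0 -> 0 < g y ->
  exists s, [/\ x <= s, s < y, g s <= 0 & forall t, s < t <= y -> 0 < g t].
Proof.
move=> cg xy gx gy.
pose S := [set t | x <= t <= y /\ g t <= 0].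
have Sx : S x by rewrite /S/= lexx xy.
have hS : has_sup S by split; [exists x|exists y => t [/andP[_ ty] _]].
have xs : x <= sup S by apply: sup_upper_bound.
have sy : sup S <= y by apply: ge_sup; [exists x|move=> t [/andP[_ ty] _]].
have gs : g (sup S) <= 0.
  rewrite leNgt; apply/negP => gs0.
  have : \forall t \near sup S, 0 < g t by exact: (cvgr_gt _ (cg (sup S))).
  move=> /nbhs_ballP[e /= e0 be].
  have [t St ts] := sup_adherent e0 hS.
  have ts' : t <= sup S by apply: sup_upper_bound.
  have : 0 < g t by apply: be; rewrite /ball/= ger0_norm ?subr_ge0//; lra.
  by case: St => _; rewrite leNgt => /negbTE ->.
exists (sup S); split => //.
  by rewrite lt_neqAle sy andbT; apply: contraTneq gs => ->; rewrite -ltNge.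
move=> t /andP[st ty]; rewrite ltNge; apply/negP => gt0.
have : t <= sup S by apply: sup_upper_bound => //; split => //; rewrite ty (le_trans xs (ltW st)).
by rewrite leNgt st.
Qed.

Lemma first_nonpositive (g : R -> R) (x y : R) : continuous g -> x <= y ->
  0 < g x -> g y <= 0 ->
  exists s, [/\ x < s, s <= y, g s <= 0 & forall t, x <= t < s -> 0 < g t].
Proof.
move=> cg xy gx gy.
have cgN : continuous (fun t => g (- t)).
  move=> t; apply: (@continuous_comp _ _ _ (fun t => - t) g); last exact: cg.
  exact: cvgN.
have xyN : - y <= - x by rewrite lerN2.
have := @last_nonpositive _ _ _ cgN xyN; rewrite !opprK => /(_ gy gx)[s [s1 s2 s3 s4]].
exists (- s); split => //; [lra|lra|].
move=> t /andP[t1 t2]; rewrite -(opprK t); apply: s4; apply/andP; split; lra.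
Qed.

End sign_changes.

(** * Slope bounds and monotonicity in the spectral parameter *)

Section krein_family.
Variables (R : realType) (A : R -> R) (r : R -> R -> R).
Local Notation leb := (@lebesgue_measure R).
Hypothesis hA : krein_string A.
Hypothesis hr : forall a, 0 <= a -> krein_solution A a (fun z => r z a).

(** The [z]-derivative of [r] for [z > 0], given by a formula that also makes sense at [z = 0], with
    value [- psi(a)]. *)
Definition krein_deriv (z a : R) : R :=
  - krein_psi r a + prim1 (krein_rhs A a (fun z => r z a)) z.

Let rhs_ge0 a : 0 <= a -> forall t, 0 <= krein_rhs A a (fun z => r z a) t.
Proof. by move=> a0 t; exact: krein_rhs_ge0 hA a0 (hr a0) t. Qed.

Let rhs_int a : 0 <= a -> forall b, 0 <= b ->
  leb.-integrable `[0, b] (EFin \o krein_rhs A a (fun z => r z a)).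
Proof. by move=> a0 b b0; exact: (krein_rhs_integrable hA (hr a0) b0). Qed.

Lemma krein0 a : 0 <= a -> r 0 a = 1.
Proof. by move=> /hr[_ _ []]. Qed.

Lemma krein_bounds z a : 0 <= z -> 0 <= a -> 0 <= r z a <= 1.
Proof. by move=> z0 /hr ha; exact: krein_solution_bounds ha _ z0. Qed.

(** [W' (0) = prim1 _ 0 = 0], so the slope at 0 is the linear coefficient. The convergence is stated
    separately since [krein_psi] is a [lim], meaningful only once the limit exists. *)
Lemma krein_psi_cvg_expansion a : 0 <= a ->
  (r h a - r 0 a) / h @[h --> 0^'+] --> - krein_psi r a /\
  exists W : R -> R,
  [/\ (forall z, 0 <= z -> r z a = 1 - krein_psi r a * z + W z),
      (forall x, is_derive x (1 : R) W (prim1 (krein_rhs A a (fun z => r z a)) x)) &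
      (forall x, x <= 0 -> W x = 0)].
Proof.
move=> a0; have [q [W [rE dW W0]]] := krein_regular hA a0 (hr a0).
have c1 : (r h a - r 0 a) / h @[h --> 0^'+] --> q.
  have [dW0 W'0] := dW 0.
  have c2 : (W h) / h @[h --> 0^'+] --> (0 : R).
    have cc : h^-1 *: ((W \o shift 0) (h *: (1 : R)) - W 0) @[h --> 0^'] --> 'D_1 W 0.
      exact: dW0.
    rewrite W'0 (prim1_le0 _ (lexx 0)) in cc.
    apply: cvg_trans (cvg_dnbhs_at_right cc); apply: near_eq_cvg; apply: nearW => h /=.
    by rewrite addr0 (W0 0)// subr0 [_ *: 1]mulr1 [RHS]mulrC.
  have c3 : q + W h / h @[h --> 0^'+] --> q + 0 by apply: cvgD c2; exact: cvg_cst.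
  rewrite addr0 in c3; apply: cvg_trans c3; apply: near_eq_cvg; near=> h.
  have h0 : 0 < h by [].
  rewrite krein0// rE ?ltW//; field; rewrite gt_eqF//.
have psiE : krein_psi r a = - q by rewrite /krein_psi (cvg_lim _ c1).
have psiEN : - krein_psi r a = q by rewrite psiE opprK.
rewrite psiEN; split; first exact: c1.
exists W; split => // z z0.
by rewrite rE// -mulNr psiEN.
Unshelve. all: end_near. Qed.

Lemma krein_is_derive (z a : R) : 0 < z -> 0 <= a ->
  is_derive z (1 : R) (fun s => r s a) (krein_deriv z a).
Proof.
move=> z0 a0; have [_ [W [rE dW W0]]] := krein_psi_cvg_expansion a0.
have eqf : \near z, 1 - krein_psi r a * z + W z = r z a.
  near=> s; rewrite rE//; near: s; apply: filterS (lt_nbhsr z0) => s; exact: ltW.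
apply: (near_eq_is_derive eqf).
apply: (@is_derive_eq _ _ _ _ _ _ _ _ (is_deriveD (is_deriveB (is_derive_cst (1 : R) z (1 : R))
   (is_deriveZ (krein_psi r a) (is_derive_id z (1 : R)))) (dW z))).
by rewrite /GRing.scale/= mulr1 sub0r.
Unshelve. all: end_near. Qed.

Lemma krein_deriv_nd a x y : 0 <= a -> x <= y -> krein_deriv x a <= krein_deriv y a.
Proof.
move=> a0 xy; rewrite lerD2l prim1_nd//.
  exact: rhs_ge0.
exact: rhs_int.
Qed.

Lemma krein_continuous_itv (a x y : R) : 0 < x -> 0 <= a ->
  {within `[x, y], continuous (fun s => r s a)}.
Proof.
move=> x0 a0; apply: derivable_within_continuous => t; rewrite in_itv/= => /andP[xt _].
by have [] := krein_is_derive (lt_le_trans x0 xt) a0.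
Qed.

(** The slope is nondecreasing in [z], so it suffices to find a nonpositive slope further right; the
    mean value theorem on [[z + 1, z + 2]], away from 0, provides one since [r] decreases. *)
Lemma krein_deriv_le0 (z a : R) : 0 <= z -> 0 <= a -> krein_deriv z a <= 0.
Proof.
move=> z0 a0; pose x := z + 1; pose y := z + 2.
have xy : x < y by rewrite /x /y ltrD2l ltr1n.
have x0 : 0 < x by rewrite /x ltr_wpDl.
have dr t : t \in `]x, y[ -> is_derive t (1 : R) (fun s => r s a) (krein_deriv t a).
  by rewrite in_itv/= => /andP[xt _]; exact: krein_is_derive (lt_trans x0 xt) a0.
have [c] := MVT xy dr (@krein_continuous_itv a x y x0 a0).
rewrite in_itv/= => /andP[xc cy] rE.
have zc : z <= c by rewrite (le_trans _ (ltW xc))// lerDl.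
apply: le_trans (krein_deriv_nd a0 zc) _.
have [rni _ _ _] := hr a0.
have : r y a - r x a <= 0.
  rewrite subr_le0; apply: rni; rewrite ?in_itv/= ?andbT; lra.
by rewrite rE pmulr_lle0// subr_gt0.
Qed.

Lemma krein_deriv_ge z a : 0 <= a -> - krein_psi r a <= krein_deriv z a.
Proof.
move=> a0; rewrite lerDl; apply: prim1_ge0; exact: rhs_ge0.
Qed.

Lemma krein_psi_ge0 a : 0 <= a -> 0 <= krein_psi r a.
Proof.
move=> a0; rewrite -oppr_le0.
exact: le_trans (krein_deriv_ge 0 a0) (krein_deriv_le0 (lexx _) a0).
Qed.

Lemma krein_deriv_cvg0 a : 0 <= a -> krein_deriv z a @[z --> 0^'+] --> - krein_psi r a.
Proof.
move=> a0.
have -> : - krein_psi r a = krein_deriv 0 a by rewrite /krein_deriv prim1_le0 ?addr0.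
suff c : {for (0 : R), continuous (fun z => krein_deriv z a)} by exact: cvg_at_right_filter c.
by apply: cvgD; [exact: cvg_cst|exact: (prim1_continuous (@rhs_int a a0))].
Qed.

Lemma prim1_krein_rhs_le z a : 0 <= z -> 0 <= a ->
  prim1 (krein_rhs A a (fun z => r z a)) z <= krein_psi r a.
Proof. by move=> z0 a0; have := krein_deriv_le0 z0 a0; rewrite /krein_deriv; lra. Qed.

(* Maximum principle: if [r z b - r z a] is positive somewhere, then from some
   point on it is positive with increasing positive slope, hence unbounded. *)
Lemma krein_le (z a b : R) : 0 <= z -> 0 <= a -> a <= b -> r z b <= r z a.
Proof.
move=> z0 a0 ab; have b0 := le_trans a0 ab.
rewrite leNgt; apply/negP => rab.
have [_ [Wa [ra dWa Wa0]]] := krein_psi_cvg_expansion a0.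
have [_ [Wb [rb dWb Wb0]]] := krein_psi_cvg_expansion b0.
pose rha := krein_rhs A a (fun z => r z a).
pose rhb := krein_rhs A b (fun z => r z b).
(* The expansions give a function differentiable on the whole line that equals [r x b - r x a] for
   [x >= 0]. *)
pose g x := (1 - krein_psi r b * x + Wb x) - (1 - krein_psi r a * x + Wa x).
pose dg x := krein_deriv x b - krein_deriv x a.
have gE x : 0 <= x -> g x = r x b - r x a by move=> x0; rewrite /g ra// rb.
have dgx x : is_derive x (1 : R) g (dg x).
  have da := is_deriveD (is_deriveB (is_derive_cst (1 : R) x (1 : R))
   (is_deriveZ (krein_psi r a) (is_derive_id x (1 : R)))) (dWa x).
  have db := is_deriveD (is_deriveB (is_derive_cst (1 : R) x (1 : R))
   (is_deriveZ (krein_psi r b) (is_derive_id x (1 : R)))) (dWb x).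
  apply: (@is_derive_eq _ _ _ _ _ _ _ _ (is_deriveB db da)).
  by rewrite /dg /krein_deriv /GRing.scale/= !mulr1 !sub0r.
have cg : continuous g.
  by move=> t; apply: differentiable_continuous; apply/derivable1_diffP; have [] := dgx t.
have gmvt x y (xy : x < y) := MVT xy (fun t _ => dgx t) (continuous_subspaceT cg).
(* Where [g] is positive, [b A r(., b) >= a A r(., a)], so [g] is convex there. *)
have dgnd x y : 0 <= x -> x <= y -> (forall t, x < t <= y -> 0 < g t) -> dg x <= dg y.
  move=> x0 xy gp.
  have ia := rhs_int a0; have ib := rhs_int b0.
  have y0 := le_trans x0 xy.
  suff : prim1 rha y - prim1 rha x <= prim1 rhb y - prim1 rhb x.
    by rewrite /dg /krein_deriv -/rha -/rhb; lra.
  have sub : `]x, y] `<=` `[0, y].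
    by move=> t /=; rewrite !in_itv/= => /andP[xt ->]; rewrite andbT ltW// (le_lt_trans x0).
  rewrite !prim1B//; apply: le_Rintegral => //.
  - by apply: integrableS (ia _ y0).
  - by apply: integrableS (ib _ y0).
  move=> t; rewrite /= in_itv/= => /andP[xt ty].
  have t0 : 0 <= t by rewrite ltW// (le_lt_trans x0).
  have At := hA.1 _ t0; have /andP[ra0 _] := krein_bounds t0 a0.
  have rab' : r t a <= r t b by rewrite -subr_ge0 -gE// ltW// gp// xt.
  rewrite /rha /rhb /krein_rhs !patchE mem_setE in_itv/= t0/=.
  by rewrite ler_pM ?mulr_ge0// ler_wpM2r.
have g00 : g 0 <= 0 by rewrite gE// !krein0// subrr.
have gz : 0 < g z by rewrite gE// subr_gt0.
have [s [s0 sz gs gps]] := last_nonpositive cg z0 g00 gz.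
have [xi] := gmvt s z sz; rewrite in_itv/= => /andP[sxi xiz] gsz.
have dgxi : 0 < dg xi.
  have : 0 < g z - g s by lra.
  by rewrite gsz pmulr_lgt0// subr_gt0.
have xi0 : 0 <= xi by lra.
have gxi : 0 < g xi by apply: gps; rewrite sxi ltW.
have gpos t : xi <= t -> 0 < g t.
  move=> xit; rewrite ltNge; apply/negP => gt0.
  have [T [xiT Tt gT gpT]] := first_nonpositive cg xit gxi gt0.
  have [c] := gmvt xi T xiT; rewrite in_itv/= => /andP[xic cT] gTE.
  have : dg xi <= dg c.
    apply: dgnd => //; first exact: ltW.
    by move=> u /andP[u1 u2]; apply: gpT; rewrite ltW//= (le_lt_trans u2).
  have : 0 < dg c * (T - xi) -> False by lra.
  by move=> F dgc; apply: F; apply: mulr_gt0; [exact: lt_le_trans dgxi dgc|rewrite subr_gt0].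
(* With slope at least [dg xi] from [xi] on, [g] has grown by at least 2 at [t], while a difference
   of values in [[0, 1]] is at most 1. *)
pose t := xi + 2 / dg xi.
have xit : xi < t by rewrite ltrDl divr_gt0.
have [c] := gmvt xi t xit; rewrite in_itv/= => /andP[xic ct] gtE.
have dc : dg xi <= dg c.
  apply: dgnd => //; first exact: ltW.
  by move=> u /andP[u1 u2]; apply: gpos; exact: ltW.
have : 2 <= dg c * (t - xi).
  rewrite /t addrAC subrr add0r mulrA ler_pdivlMr// mulrC ler_pM2r//.
have t0 : 0 <= t by lra.
have /andP[r1 r2] := krein_bounds t0 a0; have /andP[r3 r4] := krein_bounds t0 b0.
have := gE t t0; lra.
Qed.

End krein_family.

(** * Joint measurability of the family *)

Section krein_measurability.
Variables (R : realType) (A : R -> R) (r : R -> R -> R).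
Hypothesis hA : krein_string A.
Hypothesis hr : forall a, 0 <= a -> krein_solution A a (fun z => r z a).
Local Notation RR := (measurableTypeR R).

(** Clamping both arguments keeps the bounds and both monotonicities while giving a function on the
    whole plane. *)
Definition kext (z a : R) : R := r (Num.max z 0) (Num.max a 0).

Lemma kextE z a : 0 <= z -> 0 <= a -> kext z a = r z a.
Proof. by move=> z0 a0; rewrite /kext !max_l. Qed.

Let max0 (x : R) : 0 <= Num.max x 0.
Proof. by rewrite le_max lexx orbT. Qed.

Lemma kext_bounds z a : 0 <= kext z a <= 1.
Proof. exact: krein_bounds hr _ _ (max0 z) (max0 a). Qed.

Lemma kext_niz a : {homo kext ^~ a : x y /~ x <= y}.
Proof.
move=> x y xy; have [rni _ _ _] := hr (max0 a).
by apply: rni; rewrite ?in_itv/= ?andbT ?max0// ge_max max0 andbT le_max xy.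
Qed.

Lemma kext_nia z : {homo kext z : x y /~ x <= y}.
Proof.
move=> x y xy; apply: (krein_le hA hr); rewrite ?max0//.
by rewrite ge_max max0 andbT le_max xy.
Qed.

Lemma kext_right_continuous z a : kext t a @[t --> z^'+] --> kext z a.
Proof.
have [_ [W [rE dW _]]] := krein_psi_cvg_expansion hA hr (max0 a).
have cW : continuous W.
  by move=> t; apply: differentiable_continuous; apply/derivable1_diffP; have [] := dW t.
have cm : continuous (fun t : R => Num.max t 0).
  by move=> t; apply: continuous_max; [exact: cvg_id|exact: cvg_cst].
suff c : continuous (kext ^~ a) by exact: cvg_at_right_filter (c z).
rewrite (_ : kext ^~ a = fun t : R =>
  1 - krein_psi r (Num.max a 0) * Num.max t 0 + W (Num.max t 0)); last first.
  by apply/funext => t; rewrite /kext rE// max0.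
move=> t; apply: cvgD; last first.
  by apply: (@continuous_comp _ _ _ (fun t : R => Num.max t 0) W); [exact: cm|exact: cW].
apply: cvgB; first exact: cvg_cst.
by apply: cvgM; [exact: cvg_cst|exact: cm].
Qed.

Lemma measurable_kext_a z (D : set R) : measurable D -> measurable_fun D (kext z).
Proof. by move=> mD; apply: nonincreasing_measurable => // s t; exact: kext_nia. Qed.

(* Right continuity and monotonicity in [z] turn superlevel sets into countable
   unions of rectangles. *)
Lemma measurable_kext : measurable_fun setT (fun p : RR * RR => kext p.1 p.2).
Proof.
move=> mD; apply: (measurability _ (RGenOInfty.measurableE R)) => //.
move=> _ [_ [c ->] <-]; rewrite setTI.
have -> : (fun p : RR * RR => kext p.1 p.2) @^-1` `]c, +oo[ =
   \bigcup_(q : rat) ([set z : RR | z < ratr q] `*` [set a : RR | c < kext (ratr q) a]).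
  apply/seteqP; split => -[z a] /=; rewrite in_itv/= andbT.
    move=> cza.
    have : \forall t \near z^'+, c < kext t a.
      by apply: (cvgr_gt (kext z a)); [exact: kext_right_continuous|exact: cza].
    move=> /nbhs_ballP[e /= e0 be].
    have ze : z < z + e by rewrite ltrDl.
    have [q] := rat_in_itvoo ze; rewrite in_itv/= => /andP[zq qe].
    exists q => //; split => //=; apply: be => //=.
    by rewrite /ball/= ltr0_norm ?subr_lt0// opprB ltrBlDl.
  move=> [q _ [/= zq cq]]; apply: lt_le_trans cq _.
  by apply: kext_niz; exact: ltW.
apply: bigcupT_measurable_rat => q; apply: measurableX.
  have -> : [set z : RR | z < ratr q] = `]-oo, (ratr q)[%classic by rewrite set_itvE.
  exact: measurable_itv.
have := @measurable_kext_a (ratr q) setT measurableT measurableT `]c, +oo[%classic (measurable_itv _).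
by rewrite setTI; congr measurable; apply/seteqP; split => a /=; rewrite in_itv/= andbT.
Qed.

End krein_measurability.

(** * Superposition of the strings against a finite measure *)

Section krein_measurability_a.
Variables (R : realType) (A : R -> R) (r : R -> R -> R).
Hypothesis hA : krein_string A.
Hypothesis hr : forall a, 0 <= a -> krein_solution A a (fun z => r z a).

Lemma measurable_r_a (z : R) : 0 <= z -> measurable_fun `[(0 : R), +oo[ (r z).
Proof.
move=> z0; apply: (@eq_measurable_fun _ _ _ _ _ (kext r z)).
  by move=> a; rewrite inE/= in_itv/= andbT => a0; rewrite kextE.
exact: (measurable_kext_a hA hr).
Qed.

Lemma measurable_krein_psi : measurable_fun `[(0 : R), +oo[ (krein_psi r).
Proof.
pose q (n : nat) a := - ((r n.+1%:R^-1 a - r 0 a) / n.+1%:R^-1).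
apply: (@measurable_fun_cvg _ _ _ _ q).
  move=> n; apply: measurable_funN; apply: measurable_funM => //.
  by apply: measurable_funB; apply: measurable_r_a => //.
move=> a; rewrite /= in_itv/= andbT => a0.
rewrite -[krein_psi r a]opprK; apply: cvgN.
have := (cvg_at_rightP _ _ _).1 (krein_psi_cvg_expansion hA hr a0).1 harmonic; apply.
by split; [exact: harmonic_gt0|exact: cvg_harmonic].
Qed.

Lemma measurable_krein_deriv (z : R) : 0 < z -> measurable_fun `[(0 : R), +oo[ (krein_deriv A r z).
Proof.
move=> z0.
pose q (n : nat) a := n.+1%:R^-1^-1 * (r (n.+1%:R^-1 + z) a - r z a).
apply: (@measurable_fun_cvg _ _ _ _ q).
  move=> n; apply: measurable_funM => //.
  by apply: measurable_funB; apply: measurable_r_a; rewrite ?ltW ?addr_gt0 ?invr_gt0.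
move=> a; rewrite /= in_itv/= andbT => a0.
have [dr dv] := krein_is_derive hA hr z0 a0.
have cc : h^-1 *: (((fun s => r s a) \o shift z) (h *: (1 : R)) - r z a) @[h --> 0^'+] -->
    krein_deriv A r z a.
  by rewrite -dv; apply: cvg_dnbhs_at_right; exact: dr.
have := (cvg_at_rightP _ _ _).1 cc harmonic (conj harmonic_gt0 cvg_harmonic).
apply: cvg_trans; apply: near_eq_cvg; apply: nearW => n /=.
by rewrite [_ *: 1]mulr1.
Qed.

End krein_measurability_a.

(** * Weak equation for the superposition against a finite measure *)

Section krein_fubini.
Variables (R : realType) (A : R -> R) (r : R -> R -> R).
Hypothesis hA : krein_string A.
Hypothesis hr : forall a, 0 <= a -> krein_solution A a (fun z => r z a).
Local Notation RR := (measurableTypeR R).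
Local Notation leb := (@lebesgue_measure R).
Variable rho : {finite_measure set RR -> \bar R}.
Hypothesis hpsi : rho.-integrable `[0, +oo[ (EFin \o krein_psi r).

Definition krein_f (p : RR * RR) : R :=
  (A \_ `[0, +oo[) p.1 * ((@id R) \_ `[0, +oo[) p.2 * kext r p.1 p.2.

Lemma krein_fE z a : 0 <= z -> 0 <= a -> krein_f (z, a) = A z * a * r z a.
Proof.
by move=> z0 a0; rewrite /krein_f /= !patchE !mem_setE !in_itv/= z0 a0/= kextE.
Qed.

Lemma krein_f_neg z a : (z < 0) || (a < 0) -> krein_f (z, a) = 0.
Proof.
rewrite /krein_f /= !patchE !mem_setE !in_itv/= !andbT !ltNge.
by case: (0 <= z) => /=; [case: (0 <= a) => //=; rewrite mulr0 mul0r|rewrite !mul0r].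
Qed.

Lemma krein_f_ge0 p : 0 <= krein_f p.
Proof.
case: p => z a; have [z0|z0] := leP 0 z; last by rewrite krein_f_neg// z0.
have [a0|a0] := leP 0 a; last by rewrite krein_f_neg// a0 orbT.
by rewrite krein_fE// !mulr_ge0 ?hA.1//; have /andP[] := krein_bounds hr z0 a0.
Qed.

Lemma measurable_krein_string : measurable_fun setT (A \_ `[0, +oo[).
Proof.
apply/(measurable_restrictT _ _).1 => //.
have -> : `[0, +oo[%classic = \bigcup_n `[0, n%:R]%classic :> set R.
  apply/seteqP; split => t /=; rewrite in_itv/= ?andbT.
    move=> t0; exists (Num.truncn t).+1 => //=; rewrite in_itv/= t0/=.
    by rewrite ltW// truncnS_gt.
  by move=> [n _ /=]; rewrite in_itv/= => /andP[].
apply/measurable_fun_bigcup => // n.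
by have /integrableP[/measurable_EFinP] := hA.2 n%:R (ler0n _ _).
Qed.

Lemma measurable_krein_f : measurable_fun setT krein_f.
Proof.
apply: measurable_funM; last exact: (measurable_kext hA hr).
apply: measurable_funM.
  exact: (measurableT_comp measurable_krein_string).
apply: (measurableT_comp _ measurable_snd).
by apply/(measurable_restrictT _ _).1.
Qed.

Let mEf : measurable_fun setT (EFin \o krein_f).
Proof. by apply/measurable_EFinP; exact: measurable_krein_f. Qed.

Let Ef0 p : (0 <= (EFin \o krein_f) p)%E.
Proof. by rewrite lee_fin krein_f_ge0. Qed.

Definition krein_F (z : R) : \bar R := (\int[rho]_a (krein_f (z, a))%:E)%E.

Lemma measurable_krein_F : measurable_fun (setT : set RR) krein_F.
Proof. exact: (measurable_fun_fubini_tonelli_F (EFin \o krein_f) mEf Ef0). Qed.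

Lemma krein_F_ge0 z : (0 <= krein_F z)%E.
Proof. by apply: integral_ge0 => a _; exact: Ef0. Qed.

(** After Tonelli the inner integral over [z] is [prim1] of the right-hand side at [b], which
    [psi(a)] bounds whatever [b] is, and [rho] integrates [psi]. *)
Lemma integral_krein_F (b : R) : 0 <= b -> (\int[leb]_(z in `[0%R, b]) krein_F z < +oo)%E.
Proof.
move=> b0.
pose g (p : RR * RR) : \bar R := (krein_f p * \1_`[0, b] p.1)%:E.
have mg : measurable_fun setT g.
  apply/measurable_EFinP; apply: measurable_funM; first exact: measurable_krein_f.
  by apply: (measurableT_comp _ measurable_fst); exact: measurable_indic.
have g0 p : (0 <= g p)%E by rewrite lee_fin mulr_ge0// krein_f_ge0.
have -> : (\int[leb]_(z in `[0%R, b]) krein_F z = \int[leb]_z \int[rho]_a g (z, a))%E.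
  rewrite integral_mkcond; apply: eq_integral => z _; rewrite patchE mem_setE.
  rewrite /g/=; case: ifPn => zb.
    by apply: eq_integral => a _; rewrite indicE mem_setE zb mulr1.
  by rewrite integral0_eq// => a _; rewrite indicE mem_setE (negbTE zb) mulr0.
rewrite (fubini_tonelli g mg g0).
have /integrableP[_] := hpsi; apply: le_lt_trans.
rewrite [leRHS]integral_mkcond; apply: ge0_le_integral => //.
- by move=> a _; apply: integral_ge0 => z _; exact: g0.
- exact: (measurable_fun_fubini_tonelli_G g mg g0).
- apply/(measurable_restrictT _ _).1 => //; do 2 apply: measurableT_comp => //.
  by have /integrableP[/measurable_EFinP] := hpsi.
move=> a _; rewrite patchE mem_setE in_itv/= andbT; case: ifPn => a0; last first.
  by rewrite integral0_eq// => z _; rewrite /g krein_f_neg ?mul0r// [a < 0]ltNge a0 orbT.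
have gE : (\int[leb]_z g (z, a) = (prim1 (krein_rhs A a (fun z => r z a)) b)%:E)%E.
  have ir := krein_rhs_integrable hA (hr a0) b0.
  rewrite /prim1 /Rintegral fineK; last exact: integrable_fin_num.
  rewrite [RHS]integral_mkcond; apply: eq_integral => z _; rewrite patchE mem_setE /g indicE mem_setE/=.
  case: ifPn => zb; last by rewrite mulr0.
  have z0 : 0 <= z by move: zb; rewrite in_itv/= => /andP[].
  by rewrite mulr1 krein_fE// /krein_rhs /= patchE mem_setE in_itv/= z0/= [A z * a]mulrC.
by rewrite gE lee_fin ger0_norm ?(krein_psi_ge0 hA hr)// (prim1_krein_rhs_le hA hr).
Qed.

(** Finite integrals over [[0, n]] give finiteness for almost every [z] only; hence the exceptional
    set in [extension_weak_solution]. *)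
Lemma ae_krein_F_fin : {ae leb, forall z, 0 <= z -> (krein_F z < +oo)%E}.
Proof.
have H n : {ae leb, forall z, z \in `[0, n%:R] -> (krein_F z < +oo)%E}.
  have iF : leb.-integrable `[0, n%:R] krein_F.
    apply/integrableP; split; first by apply: measurable_funTS; exact: measurable_krein_F.
    under eq_integral do rewrite gee0_abs ?krein_F_ge0//.
    exact: integral_krein_F.
  have mD : measurable (`[0%R, n%:R]%classic : set RR) by exact: measurable_itv.
  have := integrable_ae mD iF; apply: filterS => z /= fF zn.
  by rewrite -ge0_fin_numE ?krein_F_ge0// fF.
have := ae_foralln H; apply: filterS => z Hz z0; apply: (Hz (Num.truncn z).+1).
by rewrite in_itv/= z0 ltW// truncnS_gt.
Qed.

Lemma krein_ALv_int z : 0 < z ->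
  (\int[rho]_(a in `[0%R, +oo[) `|(ALv_symbol A r z a)%:E| = krein_F z)%E.
Proof.
move=> z0; rewrite integral_mkcond; apply: eq_integral => a _.
rewrite patchE mem_setE in_itv/= andbT; case: ifPn => a0; last first.
  by rewrite krein_f_neg// [a < 0]ltNge a0 orbT.
suff H : `|ALv_symbol A r z a| = krein_f (z, a) by rewrite -H.
have /andP[r0 _] := krein_bounds hr (ltW z0) a0.
rewrite (krein_fE (ltW z0) a0) /ALv_symbol.
have -> : A z * (- (a : R) * r z a) = - (A z * a * r z a) by ring.
by rewrite normrN ger0_norm//; exact: (mulr_ge0 (mulr_ge0 (hA.1 _ (ltW z0)) a0) r0).
Qed.

Lemma measurable_ALv z : 0 < z -> measurable_fun `[(0 : R), +oo[ (ALv_symbol A r z).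
Proof.
move=> z0; apply: measurable_funM => //; apply: measurable_funM.
  exact: measurable_funN.
by apply: (measurable_r_a hA hr); exact: ltW.
Qed.

Lemma ae_krein_ALv : {ae leb, forall z, 0 < z ->
  rho.-integrable `[0, +oo[ (EFin \o ALv_symbol A r z)}.
Proof.
have := ae_krein_F_fin; apply: (@filterS _ _ (ae_filter_ringOfSetsType leb)) => z Fz z0; apply/integrableP; split.
  by apply/measurable_EFinP; exact: measurable_ALv.
by rewrite krein_ALv_int// Fz// ltW.
Qed.

Definition krein_W (z : R) := \int[rho]_(a in `[0, +oo[) ALv_symbol A r z a.

(** The symbol has constant sign, so no finiteness is asked: where [krein_F z] is infinite, both
    sides are 0 by the convention for [fine]. *)
Lemma krein_WE z : 0 < z -> krein_W z = - fine (krein_F z).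
Proof.
move=> z0; rewrite -krein_ALv_int// /krein_W /Rintegral -fineN; congr fine.
rewrite -integral_ge0N; last by move=> a _; exact: abse_ge0.
apply: eq_integral => a; rewrite inE/= in_itv/= andbT => a0.
have /andP[r0 _] := krein_bounds hr (ltW z0) a0.
have -> : ALv_symbol A r z a = - (A z * a * r z a) by rewrite /ALv_symbol; ring.
by rewrite normrN ger0_norm//; exact: (mulr_ge0 (mulr_ge0 (hA.1 _ (ltW z0)) a0) r0).
Qed.

Lemma locally_integrable_dom (f : R -> R) (G : R -> \bar R) :
    measurable_fun (`]0%R, +oo[%classic : set R) f ->
    (forall z, (0 <= G z)%E) -> measurable_fun (setT : set R) G ->
    (forall b, 0 <= b -> (\int[leb]_(z in `[0%R, b]) G z < +oo)%E) ->
    (forall z, 0 < z -> (`|f z|%:E <= G z)%E) ->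
  locally_integrable `]0, +oo[ f.
Proof.
move=> mf G0 mG iG fG; split => //.
move=> K Kpos cK.
have [M [_ KM]] := compact_bounded cK.
pose b := `|M| + 1.
have b0 : 0 <= b by rewrite addr_ge0.
have Kb : K `<=` `[0%R, b].
  move=> z Kz; have := Kpos _ Kz; rewrite /= !in_itv/= andbT => z0.
  rewrite ltW//=; have := KM b; rewrite /b (le_lt_trans (ler_norm M)) ?ltrDl// => /(_ isT z Kz).
  by apply: le_trans; exact: ler_norm.
have mK : measurable K by exact: compact_measurable.
apply: le_lt_trans (iG b b0).
apply: (@le_trans _ _ (\int[leb]_(z in K) G z)%E).
  apply: ge0_le_integral => //.
  - by apply/measurable_EFinP; apply: measurableT_comp => //; exact: measurable_funS mf.
  - exact: measurable_funTS.
  - by move=> z /Kpos; rewrite /= in_itv/= andbT => z0; exact: fG.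
by apply: ge0_subset_integral => //; exact: measurable_funTS.
Qed.

Lemma krein_W_locally_integrable : locally_integrable `]0, +oo[ krein_W.
Proof.
apply: (@locally_integrable_dom _ krein_F).
- apply: (@eq_measurable_fun _ _ _ _ _ (fun z => - fine (krein_F z))).
    by move=> z; rewrite inE/= in_itv/= andbT => z0; rewrite krein_WE.
  apply: measurable_funTS; apply: measurable_funN.
  exact: (measurableT_comp (fine_measurable measurableT) measurable_krein_F).
- exact: krein_F_ge0.
- exact: measurable_krein_F.
- exact: integral_krein_F.
move=> z z0; rewrite krein_WE// normrN; have := krein_F_ge0 z.
by case: (krein_F z) => [x||]//=; rewrite ?normr0// lee_fin => x0; rewrite ger0_norm.
Qed.

Let measurable_krein_I : measurable_fun (`]0%R, +oo[%classic : set R)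
  (fun z => \int[rho]_(a in `[0, +oo[) r z a).
Proof.
pose g (p : RR * RR) : \bar R := (\1_(`[0, +oo[%classic : set R) p.2 * kext r p.1 p.2)%:E.
have mg : measurable_fun setT g.
  apply/measurable_EFinP; apply: measurable_funM; last exact: (measurable_kext hA hr).
  by apply: (measurableT_comp _ measurable_snd); exact: measurable_indic.
have g0 p : (0 <= g p)%E.
  by rewrite lee_fin mulr_ge0//; have /andP[] := kext_bounds hr p.1 p.2.
have mF := @measurable_fun_fubini_tonelli_F _ _ _ _ _ rho g mg g0.
apply: (@eq_measurable_fun _ _ _ _ _ (fun z => fine (fubini_F rho g z))); last first.
  by apply: measurable_funTS; exact: (measurableT_comp (fine_measurable measurableT) mF).
move=> z; rewrite inE/= in_itv/= andbT => z0; congr fine; rewrite [RHS]integral_mkcond.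
apply: eq_integral => a _; rewrite /g patchE mem_setE /= indicE mem_setE in_itv/= andbT.
by case: ifPn => a0; rewrite ?mul0r// mul1r (kextE _ (ltW z0) a0).
Qed.

Let rho_int_r z : 0 <= z -> rho.-integrable `[0, +oo[ (EFin \o r z).
Proof.
move=> z0; apply: measurable_bounded_integrable => //.
- by rewrite -ge0_fin_numE// fin_num_measure.
- exact: (measurable_r_a hA hr).
exists 1; split => // M M1 a /=; rewrite in_itv/= andbT => a0.
by have /andP[r0 r1] := krein_bounds hr z0 a0; rewrite (le_trans _ (ltW M1))// ger0_norm.
Qed.

Lemma krein_I_locally_integrable :
  locally_integrable `]0, +oo[ (fun z => \int[rho]_(a in `[0, +oo[) r z a).
Proof.
pose C := fine (rho (`[(0 : R), +oo[%classic : set RR)).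
have C0 : 0 <= C by rewrite fine_ge0.
apply: (@locally_integrable_dom _ (cst C%:E)) => //.
- move=> b b0; rewrite integral_cst//= lebesgue_measure_itv/=.
  by case: ifPn => _; rewrite ?mule0// -EFinB -EFinM ltry.
move=> z z0; rewrite lee_fin ger0_norm; last first.
  by apply: Rintegral_ge0 => a; rewrite /= in_itv/= andbT => /(krein_bounds hr (ltW z0))/andP[].
rewrite /C -[fine _]mul1r -Rintegral_cst//; apply: le_Rintegral => //.
- exact: rho_int_r (ltW z0).
- exact: finite_measure_integrable_cst.
by move=> a; rewrite /= in_itv/= andbT => /(krein_bounds hr (ltW z0))/andP[].
Qed.

(** Exchange the integrals, use the equation of [r(., a)] for each [a], exchange back. The first
    exchange rests on [0 <= r <= 1] and the finiteness of [rho], the second on [integral_krein_F]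
    over the support of [eta]. *)
Lemma krein_weak_rho : weak_deriv2 (fun z => \int[rho]_(a in `[0, +oo[) r z a)
  (fun z => - krein_W z).
Proof.
split; [exact: krein_I_locally_integrable| |].
  have [mW oW iW] := krein_W_locally_integrable.
  split; [exact: measurable_funN|exact: oW|move=> K Kp cK].
  by under eq_integral do rewrite normrN; exact: iW.
move=> eta te.
have [x0 [b [x00 x0b out]]] := test_function_supp te.
have b0 : 0 <= b by lra.
have ce n := @test_function_continuous _ eta n te.
pose et n := (derive1n n eta) \_ (`]0, +oo[%classic : set R).
have met n : measurable_fun setT (et n).
  apply/(measurable_restrictT _ _).1 => //.
  by apply: measurable_funTS; apply: continuous_measurable_fun; exact: ce.
have iet n : leb.-integrable setT (EFin \o et n).
  rewrite /et -restrict_EFin; apply/integrable_restrict => //; rewrite setTI.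
  have := @integrable_mul_test _ (cst 1) eta n te.
  have i1 c : 0 <= c -> leb.-integrable `[0, c] (EFin \o cst (1 : R)).
    by move=> c0; apply: continuous_integrable_itv => x; exact: cvg_cst.
  by move=> /(_ i1); congr integrable; apply/funext => t /=; rewrite mul1r.
pose oneD := \1_(`[0, +oo[%classic : set RR) : RR -> R.
have iD : rho.-integrable setT (EFin \o oneD).
  apply: measurable_bounded_integrable => //.
  - by rewrite -ge0_fin_numE// fin_num_measure.
  - by apply: measurable_indic.
  exists 1; split => // M M1 a _ /=; rewrite (le_trans _ (ltW M1))//.
  by rewrite /oneD indicE; case: (_ \in _); rewrite ?normr1 ?normr0.
pose g1 (p : RR * RR) : R := et 2%N p.1 * oneD p.2 * kext r p.1 p.2.
have ig1 : (leb \x rho)%E.-integrable setT (EFin \o g1).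
  apply: (integrableMl _ (integrable_prod_mul (iet 2%N) iD)) => //.
    exact: (measurable_kext hA hr).
  exists 1; split => // M M1 p _ /=; rewrite (le_trans _ (ltW M1))//.
  by have /andP[k0 k1] := kext_bounds hr p.1 p.2; rewrite ger0_norm.
pose g2 (p : RR * RR) : R := krein_f p * et 0%N p.1.
have mg2 : measurable_fun setT g2.
  apply: measurable_funM; first exact: measurable_krein_f.
  exact: (measurableT_comp (met 0%N)).
have [C0 [C00 etC]] : exists C, 0 <= C /\ forall z, `|et 0%N z| <= C * \1_(`[0, b]%classic : set R) z.
  have cn : {within `[0, b], continuous (fun t => `|eta t|)}.
    by apply: continuous_subspaceT => t; apply: cvg_norm; exact: (ce 0%N).
  have [c _ cE] := EVT_max b0 cn; exists `|eta c|; split => // z.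
  rewrite /et patchE indicE !mem_setE.
  have [zb|zb] := boolP (z \in `[0, b]); last first.
    rewrite mulr0; case: ifPn => zp; last by rewrite normr0.
    rewrite (out 0%N) ?normr0//; apply: contraNN zb => /andP[z1 z2].
    by rewrite in_itv/= z2 andbT (le_trans _ z1)// ltW.
  by rewrite mulr1; case: ifPn => _; rewrite ?normr0//; exact: cE.
have ig2 : (leb \x rho)%E.-integrable setT (EFin \o g2).
  apply/integrable12ltyP; first exact/measurable_EFinP.
  have ib := integral_krein_F b0.
  apply: (@le_lt_trans _ _ (\int[leb]_(z in `[0%R, b]) (C0%:E * krein_F z))%E); last first.
    rewrite ge0_integralZl//; [|by apply: measurable_funTS; exact: measurable_krein_F|by move=> z _; exact: krein_F_ge0].
    by apply: lte_mul_pinfty; rewrite ?lee_fin.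
  rewrite [leRHS]integral_mkcond.
  have mFk : measurable_fun (setT : set RR) (fun z => C0%:E * krein_F z)%E.
    by apply: emeasurable_funM => //; exact: measurable_krein_F.
  apply: ge0_le_integral => //.
  - by move=> z _; apply: integral_ge0.
  - apply: (measurable_fun_fubini_tonelli_F (fun p => `|(g2 p)%:E|)%E) => //.
    by apply/measurable_EFinP; apply: measurableT_comp.
  - apply/(measurable_restrictT _ _).1 => //; exact: measurable_funTS.
  move=> z _; rewrite patchE mem_setE.
  have -> : (\int[rho]_y `|(EFin \o g2) (z, y)| = `|et 0%N z|%:E * krein_F z)%E.
    rewrite -ge0_integralZl//; last first.
    - by move=> a _; exact: Ef0.
    - apply/measurable_EFinP; exact: (measurableT_comp measurable_krein_f (measurable_pair1 z)).
    apply: eq_integral => a _.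
    by rewrite /g2/= normrM [`|krein_f _|]ger0_norm ?krein_f_ge0// mulrC.
  have := etC z; rewrite indicE mem_setE; case: ifPn => _ hC.
    by apply: lee_wpmul2r; [exact: krein_F_ge0|rewrite lee_fin; move: hC; rewrite mulr1].
  by move: hC; rewrite mulr0 normr_le0 => /eqP ->; rewrite normr0 mul0e.
transitivity (\int[leb]_z (\int[rho]_a g1 (z, a))).
  rewrite Rintegral_mkcond; apply: eq_Rintegral => z _.
  rewrite patchE mem_setE in_itv/= andbT /g1/= /et patchE mem_setE in_itv/= andbT.
  case: ifPn => z0; last first.
    by rewrite (@eq_Rintegral _ _ _ _ _ (cst 0)) ?Rintegral_cst ?mul0r// => a _; rewrite !mul0r.
  rewrite mulrC Rintegral_mkcond -RintegralZl//; last first.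
    rewrite -restrict_EFin; apply/integrable_restrict => //; rewrite setTI.
    exact: rho_int_r (ltW z0).
  apply: eq_Rintegral => a _; rewrite -mulrA; congr (_ * _).
  rewrite patchE /oneD indicE !mem_setE in_itv/= andbT.
  by case: ifPn => a0; rewrite ?mul0r// mul1r (kextE _ (ltW z0) a0).
rewrite (Rintegral_fubini ig1).
(* For [a < 0] the cutoffs make both inner integrals vanish; for [a >= 0] this is the weak equation
   of [r(., a)]. *)
transitivity (\int[rho]_a (\int[leb]_z g2 (z, a))).
  apply: eq_Rintegral => a _.
  have [a0|a0] := leP 0 (a : R); last first.
    rewrite (@eq_Rintegral _ _ _ _ _ (cst 0)); last first.
      by move=> z _; rewrite /g1/= /oneD indicE mem_setE in_itv/= andbT leNgt a0/= mulr0 mul0r.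
    by apply: eq_Rintegral => z _; rewrite /g2 krein_f_neg ?mul0r// a0 orbT.
  have [_ [_ _ wr] _ _] := hr a0.
  transitivity (\int[leb]_(z in `]0, +oo[) (r z a * derive1n 2 eta z)).
    rewrite [RHS]Rintegral_mkcond; apply: eq_Rintegral => z _.
    rewrite /g1/= /et /oneD indicE !patchE !mem_setE !in_itv/= !andbT a0 mulr1 [RHS]/=.
    by case: ifPn => z0; rewrite ?mul0r// (kextE _ (ltW z0) a0) mulrC.
  rewrite wr//.
  rewrite [LHS]Rintegral_mkcond; apply: eq_Rintegral => z _.
  rewrite /g2 /et !patchE !mem_setE !in_itv/= !andbT.
  case: ifPn => z0; last by rewrite mulr0.
  by rewrite (krein_fE (ltW z0) a0) [A z * a]mulrC.
rewrite -(Rintegral_fubini ig2) [RHS]Rintegral_mkcond; congr fine.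
apply: ae_eq_integral => //.
- apply/measurable_EFinP; apply: (measurableT_comp (fine_measurable measurableT)).
  exact: measurable_fubini_F ig2.
- apply/measurable_EFinP; apply/(measurable_restrictT _ _).1 => //.
  apply: measurable_funM; last by apply: measurable_funTS; apply: continuous_measurable_fun; exact: (ce 0%N).
  by apply: measurable_funN; have [] := krein_W_locally_integrable.
(* Pulling [eta z] out of the integral over [rho] uses integrability of the section, available for
   almost every [z]. *)
have := ae_krein_F_fin; apply: (@filterS _ _ (ae_filter_ringOfSetsType leb)) => z Fz _.
congr EFin; rewrite patchE mem_setE in_itv/= andbT; case: ifPn => z0; last first.
  rewrite (@eq_Rintegral _ _ _ _ _ (cst 0)) ?Rintegral_cst ?mul0r// => a _.
  by rewrite /g2 /et patchE mem_setE in_itv/= andbT (negbTE z0) mulr0.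
rewrite krein_WE// opprK /g2.
have izf : rho.-integrable setT (EFin \o (fun a => krein_f (z, a))).
  apply/integrableP; split.
    by apply/measurable_EFinP; exact: (measurableT_comp measurable_krein_f (measurable_pair1 z)).
  under eq_integral do rewrite gee0_abs ?Ef0//.
  by apply: Fz; exact: ltW.
have etz : et 0%N z = eta z by rewrite /et patchE mem_setE in_itv/= z0.
by rewrite -etz -(RintegralZr (et 0%N z) measurableT izf).
Qed.

End krein_fubini.

(** * Differentiation under the integral and the limit at 0+ *)

Section krein_derivative_integral.
Variables (R : realType) (A : R -> R) (r : R -> R -> R).
Hypothesis hA : krein_string A.
Hypothesis hr : forall a, 0 <= a -> krein_solution A a (fun z => r z a).
Local Notation RR := (measurableTypeR R).
Variable rho : {finite_measure set RR -> \bar R}.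
Hypothesis hpsi : rho.-integrable `[0, +oo[ (EFin \o krein_psi r).

Lemma integrable_r z : 0 <= z -> rho.-integrable `[0, +oo[ (EFin \o r z).
Proof.
move=> z0; apply: measurable_bounded_integrable => //.
- by rewrite -ge0_fin_numE// fin_num_measure.
- exact: (measurable_r_a hA hr).
exists 1; split => // M M1 a /=; rewrite in_itv/= andbT => a0.
by have /andP[r0 r1] := krein_bounds hr z0 a0; rewrite (le_trans _ (ltW M1))// ger0_norm.
Qed.

Lemma krein_deriv_norm_le z a : 0 <= z -> 0 <= a ->
  `|krein_deriv A r z a| <= krein_psi r a.
Proof.
move=> z0 a0; have h1 := krein_deriv_le0 hA hr z0 a0; have h2 := krein_deriv_ge hA hr z a0.
by rewrite ler0_norm// lerNl.
Qed.

Lemma integrable_krein_deriv z : 0 < z -> rho.-integrable `[0, +oo[ (EFin \o krein_deriv A r z).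
Proof.
move=> z0; apply: le_integrable hpsi => //.
  by apply/measurable_EFinP; exact: (measurable_krein_deriv hA hr).
move=> a; rewrite /= in_itv/= andbT => a0; rewrite lee_fin.
by rewrite (le_trans (krein_deriv_norm_le (ltW z0) a0))// ler_norm.
Qed.

Lemma is_derive_Rintegral_r (z : R) : 0 < z ->
  is_derive z (1 : R) (fun s => \int[rho]_(a in `[0, +oo[) r s a)
    (\int[rho]_(a in `[0, +oo[) krein_deriv A r z a).
Proof.
move=> z0.
pose G a := `|krein_psi r a|.
have iG : rho.-integrable `[0, +oo[ (EFin \o G) by exact: (integrable_abse hpsi).
(* An open neighbourhood of [z] inside the positive half line, where [psi] dominates the slopes. *)
have Iz : (`]0, (z + 1)[%classic : set R) z by rewrite /= in_itv/= z0 ltrDl ltr01.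
have dE s a : 0 < s -> 0 <= a -> partial1of2 r s a = krein_deriv A r s a.
  move=> s0 a0; rewrite partial1of2E.
  by have dr := krein_is_derive hA hr s0 a0; exact: derive_val.
have H1 s : `]0, (z + 1)[%classic s -> rho.-integrable `[0, +oo[ (EFin \o r s).
  by rewrite /= in_itv/= => /andP[s0 _]; apply: integrable_r; exact: ltW.
have H2 s a : `]0, (z + 1)[%classic s -> `[0, +oo[%classic a -> derivable (r^~ a) s 1.
  rewrite /= !in_itv/= andbT => /andP[s0 _] a0.
  by have [] := krein_is_derive hA hr s0 a0.
have H3 s a : `]0, (z + 1)[%classic s -> `[0, +oo[%classic a -> `|partial1of2 r s a| <= G a.
  rewrite /= !in_itv/= andbT => /andP[s0 _] a0.
  by rewrite dE// (le_trans (krein_deriv_norm_le (ltW s0) a0))// ler_norm.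
have mD : measurable (`[0, +oo[%classic : set RR) by exact: measurable_itv.
have G0 a : 0 <= G a by exact: normr_ge0.
apply: DeriveDef.
  exact: (derivable_under_integral mD Iz H1 H2 G0 iG H3).
rewrite -derive1E (differentiation_under_integral mD Iz H1 H2 G0 iG H3).
by apply: eq_Rintegral => a; rewrite inE/= in_itv/= andbT => a0; exact: dE.
Qed.

Lemma Rintegral_krein_deriv_cvg0 :
  \int[rho]_(a in `[0, +oo[) krein_deriv A r z a @[z --> 0^'+] -->
  \int[rho]_(a in `[0, +oo[) (- krein_psi r a).
Proof.
apply/cvg_at_rightP => u [u0 ucvg].
have mD : measurable (`[0, +oo[%classic : set RR) by exact: measurable_itv.
have ipN : rho.-integrable `[0, +oo[ (EFin \o (fun a => - krein_psi r a)).
  by have := integrableN hpsi; congr integrable.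
apply: fine_cvg; rewrite fineK; last exact: integrable_fin_num.
apply: (@dominated_cvg _ _ _ rho _ mD (fun n a => (krein_deriv A r (u n) a)%:E) _
  (EFin \o krein_psi r)) => //=.
- by move=> n; apply: measurable_int (integrable_krein_deriv (u0 n)).
- move=> a; rewrite in_itv/= andbT => a0; apply: cvg_EFin; first exact: nearW.
  exact: ((cvg_at_rightP _ _ _).1 (krein_deriv_cvg0 hA hr a0) u (conj u0 ucvg)).
- by move=> n a; rewrite in_itv/= andbT => a0; rewrite lee_fin krein_deriv_norm_le// ltW.
Qed.

End krein_derivative_integral.

(** * The space L2 *)

Section L2_theory.
Context d (T : measurableType d) (R : realType).
Variable mu : {measure set T -> \bar R}.
Local Notation H := (L2 mu).
Implicit Types u v w g : H.

Lemma integrable_L2_mul u v : mu.-integrable setT (EFin \o (fun x => u x * v x)).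
Proof.
by apply/Lfun1_integrable; apply: Lfun2_mul_Lfun1; exact: LfunP.
Qed.

Lemma l2dotC u v : l2dot u v = l2dot v u.
Proof. by apply: eq_Rintegral => x _; rewrite mulrC. Qed.

Lemma l2dotDZl a u v w : l2dot (a *: u + v) w = a * l2dot u w + l2dot v w.
Proof.
rewrite /l2dot -RintegralZl//; last exact: integrable_L2_mul.
rewrite -RintegralD//; [|exact: (integrableZl _ a (integrable_L2_mul u w))|exact: integrable_L2_mul].
by apply: eq_Rintegral => x _; rewrite /= mulrDl mulrA.
Qed.

Lemma l2dotZl a u w : l2dot (a *: u) w = a * l2dot u w.
Proof.
rewrite /l2dot -RintegralZl//; last exact: integrable_L2_mul.
by apply: eq_Rintegral => x _; rewrite /= mulrA.
Qed.

Lemma l2dotDl u v w : l2dot (u + v) w = l2dot u w + l2dot v w.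
Proof. by have := l2dotDZl 1 u v w; rewrite scale1r mul1r. Qed.

Lemma l2dotNl u w : l2dot (- u) w = - l2dot u w.
Proof. by rewrite -scaleN1r l2dotZl mulN1r. Qed.

Lemma l2dotBl u v w : l2dot (u - v) w = l2dot u w - l2dot v w.
Proof. by rewrite l2dotDl l2dotNl. Qed.

Lemma l2dotBr u v w : l2dot w (u - v) = l2dot w u - l2dot w v.
Proof. by rewrite ![l2dot w _]l2dotC l2dotBl. Qed.

Lemma l2dotZr a u w : l2dot w (a *: u) = a * l2dot w u.
Proof. by rewrite ![l2dot w _]l2dotC l2dotZl. Qed.

Lemma l2dot0l w : l2dot 0 w = 0.
Proof. by rewrite -(scale0r w) l2dotZl mul0r. Qed.

Lemma l2dot_ge0 u : 0 <= l2dot u u.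
Proof. by apply: Rintegral_ge0 => x _; rewrite -expr2 sqr_ge0. Qed.

Lemma l2dot_ae_eq u v w : u = v %[ae mu] -> l2dot u w = l2dot v w.
Proof.
move=> uv; congr fine; apply: ae_eq_integral => //.
- by apply/measurable_EFinP; apply: measurable_funM.
- by apply/measurable_EFinP; apply: measurable_funM.
- by apply: filterS uv => x /= /(_ I) ->.
Qed.

(** Young's inequality, from the square of [t *: u - g]; it stands in for Cauchy-Schwarz
    throughout. *)
Lemma l2dot_le u g t : 0 < t -> 2 * l2dot u g <= t * l2dot u u + t^-1 * l2dot g g.
Proof.
move=> t0; have := l2dot_ge0 (t *: u - g).
rewrite l2dotBl !l2dotBr !l2dotZl !l2dotZr (l2dotC g u) => h.
rewrite -(ler_pM2l t0) mulrDr [X in _ <= _ + X]mulrA divff ?gt_eqF// mul1r; lra.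
Qed.

Lemma l2dot_eq0 u : l2dot u u = 0 -> u = 0 %[ae mu].
Proof.
move=> u0; have iu := integrable_L2_mul u u.
have : (\int[mu]_x `|(u x * u x)%:E| = 0)%E.
  transitivity (\int[mu]_x (u x * u x)%:E)%E.
    by apply: eq_integral => x _; rewrite gee0_abs// lee_fin -expr2 sqr_ge0.
  by rewrite -[LHS]fineK ?integrable_fin_num//; congr EFin.
have mu2 : measurable_fun setT (fun x => (u x * u x)%:E) by exact: measurable_int iu.
move/(ae_eq_integral_abs mu measurableT mu2).1; apply: filterS => x /= /(_ I) [] /eqP.
by rewrite mulf_eq0 orbb => /eqP ->.
Qed.

Lemma l2dot_inj u v : (forall g, l2dot u g = l2dot v g) -> u = v %[ae mu].
Proof.
move=> uv; have : l2dot (u - v) (u - v) = 0 by rewrite l2dotBl uv subrr.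
by move/l2dot_eq0; apply: filterS => x /= /(_ I) uvx _; apply/eqP; rewrite -subr_eq0; apply/eqP; exact: uvx.
Qed.

Lemma L2_of_sqr (h : T -> R) : measurable_fun setT h ->
  (\int[mu]_x (h x ^+ 2)%:E < +oo)%E -> exists u : H, u =1 h.
Proof.
move=> mh ih.
have hP : h \in Lfun mu 2%:E.
  apply/andP; split; rewrite inE//= /finite_norm unlock /Lnorm.
  apply: poweR_lty; apply: le_lt_trans ih.
  by under eq_integral do rewrite abse_EFin poweR_EFin powR_mulrn// real_normK ?num_real//.
by exists (Lfun_Sub (lee1n 2) hP) => x; rewrite Lfun_valP.
Qed.

End L2_theory.

(** * Completeness of the space *)

Section L2_complete.
Context d (T : measurableType d) (R : realType).
Variable mu : {measure set T -> \bar R}.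
Local Notation H := (L2 mu).

(** [e k] is the tail of the geometric bounds from [k] on. Subtracting it makes [u] nondecreasing
    and adding it makes [u] nonincreasing, so monotone convergence of real sequences suffices. *)
Lemma cvg_of_geometric_increments (u : nat -> R) (c : R) :
  (forall k, `|u k.+1 - u k| <= c * 2^-1 ^+ k) -> cvgn u.
Proof.
move=> uc; pose e k : R := 2 * c * 2^-1 ^+ k.
have c0 : 0 <= c by have := uc 0%N; rewrite expr0 mulr1; apply: le_trans.
have e0 k : 0 <= e k by rewrite !mulr_ge0// exprn_ge0.
have eS k : e k - e k.+1 = c * 2^-1 ^+ k by rewrite /e exprS; field.
have ecvg : e @ \oo --> (0 : R).
  rewrite -(mulr0 (2 * c)); apply: cvgM; first exact: cvg_cst.
  by apply: cvg_expr; rewrite ger0_norm ?invr_ge0// invf_lt1// ltr1n.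
have nd : nondecreasing_seq (fun k => u k - e k).
  apply/nondecreasing_seqP => k; have := uc k; rewrite ler_norml => /andP[h1 h2].
  by have := eS k; lra.
have ni : nonincreasing_seq (fun k => u k + e k).
  apply/nonincreasing_seqP => k; have := uc k; rewrite ler_norml => /andP[h1 h2].
  by have := eS k; lra.
have cv : cvgn (fun k => u k - e k).
  apply: nondecreasing_is_cvgn => //; exists (u 0%N + e 0%N) => _ [k _ <-].
  by have := ni 0%N k (leq0n k); have := e0 k; lra.
have -> : u = (fun k => u k - e k) \+ e by apply/funext => k /=; rewrite subrK.
by apply: is_cvgD => //; apply/cvg_ex; exists 0.
Qed.

Lemma integral_sqr_l2dot (u : H) : (\int[mu]_x (u x ^+ 2)%:E = (l2dot u u)%:E)%E.
Proof.
rewrite /l2dot /Rintegral fineK; last exact: integrable_fin_num (integrable_L2_mul u u).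
by apply: eq_integral => x _; rewrite expr2.
Qed.

Lemma limn_einf_le (u : nat -> \bar R) (e : \bar R) : (forall k, u k <= e)%E -> (limn_einf u <= e)%E.
Proof.
move=> ue; rewrite limn_einf_lim; apply: lime_le; first exact: is_cvg_einfs.
apply: nearW => n; apply: le_trans (ue n); apply: ereal_inf_lbound.
by exists n => /=.
Qed.

(* A subsequence with increments of norm at most [8^-k] converges almost
   everywhere, since [\sum 4^k |u_(k+1) - u_k|^2] has finite integral; Fatou's
   lemma then shows that its limit is the limit in norm. *)
Lemma l2_complete (w_ : nat -> H) :
    (forall e, 0 < e -> exists N, forall m n, (N <= m)%N -> (N <= n)%N ->
      l2dot (w_ m - w_ n) (w_ m - w_ n) < e) ->
  exists w : H, forall g : H, l2dot (w_ n) g @[n --> \oo] --> l2dot w g.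
Proof.
move=> cw.
have c8 (k : nat) : 0 < (8^-1 : R) ^+ k by rewrite exprn_gt0.
have /choice[N hN] k := cw _ (c8 k).
(* One formula gives an index that is nondecreasing in [k] and at least both [k] and [N k]. *)
pose n_ k := (k + \sum_(i < k.+1) N i)%N.
have nN k : (N k <= n_ k)%N.
  by rewrite /n_ big_ord_recr/= addnA leq_addl.
have nS k : (n_ k <= n_ k.+1)%N.
  by rewrite /n_ [in leqRHS]big_ord_recr/= addSn leqW// leq_add2l leq_addr.
have nk k : (k <= n_ k)%N by rewrite leq_addr.
pose u k := w_ (n_ k).
have du k : l2dot (u k.+1 - u k) (u k.+1 - u k) < 8^-1 ^+ k.
  by apply: hN => //; exact: leq_trans (nS k).
(* The weight [4^k] serves twice: against [8^-k] the integrals sum like [2^-k], and a finite sum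
   [Q x] bounds the increments at [x] by [2^-k] times the square root of [Q x]. *)
pose q k (x : T) : R := 4 ^+ k * (u k.+1 x - u k x) ^+ 2.
have mq k : measurable_fun setT (q k).
  by apply: measurable_funM => //; apply: measurable_funX; apply: measurable_funB.
have q0 k x : 0 <= q k x by apply: mulr_ge0; [exact: exprn_ge0|exact: sqr_ge0].
pose Q x : \bar R := (\sum_(0 <= k <oo) (q k x)%:E)%E.
have mQ : measurable_fun setT Q.
  apply: (emeasurable_fun_cvg (fun n x => (\sum_(0 <= k < n) q k x)%:E)).
    by move=> n; apply/measurable_EFinP; exact: measurable_sum.
  move=> x _; under eq_fun do rewrite -sumEFin.
  by apply: is_cvg_nneseries => n _ _; rewrite lee_fin.
have Q0 x : (0 <= Q x)%E by apply: nneseries_ge0 => n _ _; rewrite lee_fin.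
have iQ : mu.-integrable setT Q.
  apply/integrableP; split => //; under eq_integral do rewrite gee0_abs//.
  rewrite integral_nneseries//; last 2 first.
    by move=> n; exact/measurable_EFinP.
    by move=> n x _; rewrite lee_fin.
  apply: (@le_lt_trans _ _ 2%:E); last by rewrite ltry.
  apply: lime_le; first by apply: is_cvg_nneseries => n _ _; apply: integral_ge0 => x _; rewrite lee_fin.
  apply: nearW => n.
  have qk k : (\int[mu]_x (q k x)%:E = (4 ^+ k * l2dot (u k.+1 - u k) (u k.+1 - u k))%:E)%E.
    have mk2 : measurable_fun setT (fun x => ((u k.+1 x - u k x) ^+ 2)%:E).
      by apply/measurable_EFinP; apply: measurable_funX; apply: measurable_funB.
    have k20 x : setT x -> (0 <= ((u k.+1 x - u k x) ^+ 2)%:E)%E by rewrite lee_fin sqr_ge0.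
    rewrite EFinM -integral_sqr_l2dot.
    by apply: (ge0_integralZl_EFin mu measurableT k20 mk2); exact: exprn_ge0.
  under eq_bigr do rewrite qk; rewrite sumEFin lee_fin.
  apply: (@le_trans _ _ (2 - 2 * 2^-1 ^+ n)); last by rewrite gerBl mulr_ge0// exprn_ge0.
  elim: n => [|n IH]; first by rewrite big_geq// expr0 mulr1 subrr.
  rewrite big_nat_recr//=.
  have : 4 ^+ n * l2dot (u n.+1 - u n) (u n.+1 - u n) <= 2^-1 ^+ n.
    apply: (@le_trans _ _ (4 ^+ n * 8^-1 ^+ n)).
      by apply: ler_wpM2l; [rewrite exprn_ge0|exact: ltW].
    by rewrite -exprMn (_ : 4 / 8 = 2^-1)//; field.
  rewrite exprS; lra.
pose G := [set x | Q x \is a fin_num].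
have mG : measurable G by rewrite -[G]setTI; exact: emeasurable_fin_num.
have aeG : {ae mu, forall x, G x}.
  by have := integrable_ae measurableT iQ; apply: filterS => x /(_ I).
pose v k : T -> R := (u k : T -> R) \_ G.
have mv k : measurable_fun setT (v k).
  by apply/(measurable_restrictT _ mG).1; exact: measurable_funTS.
have cv x : cvgn (v ^~ x).
  have [Gx|nGx] := pselect (G x); last first.
    apply/cvg_ex; exists 0; rewrite (_ : v ^~ x = cst 0); first exact: cvg_cst.
    by apply/funext => k; rewrite /v patchE memNset.
  rewrite (_ : v ^~ x = (fun k => u k x)); last by apply/funext => k; rewrite /v patchE mem_set.
  apply: (@cvg_of_geometric_increments _ (Num.sqrt (fine (Q x)))) => k.
  have qQ : q k x <= fine (Q x).
    rewrite -lee_fin fineK// /Q (@nneseriesD1 _ _ k)//; last by move=> j _; rewrite lee_fin.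
    by rewrite leeDl// nneseries_ge0// => j _ _; rewrite lee_fin.
  rewrite -(ger0_norm (mulr_ge0 (sqrtr_ge0 (fine (Q x))) (exprn_ge0 k (_ : 0 <= 2^-1))))//.
  rewrite -ler_sqr ?nnegrE// !real_normK ?num_real// exprMn sqr_sqrtr; last by rewrite fine_ge0.
  apply: le_trans (ler_wpM2r _ qQ); last by rewrite sqr_ge0.
  rewrite /q -exprM mulnC exprM mulrAC -exprMn (_ : 4 * 2^-1 ^+ 2 = 1) ?expr1n ?mul1r//.
  by field.
pose w x := limn (v ^~ x).
have mw : measurable_fun setT w.
  by apply: (measurable_fun_cvg mv) => x _; exact: cv.
(* Used with [y = u 0], to place the limit in the space, and with [y = w_ n], for convergence in
   norm. *)
have fat (y : H) (e : R) (K : nat) : (forall k, (K <= k)%N -> l2dot (u k - y) (u k - y) <= e) ->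
    (\int[mu]_x ((w x - y x) ^+ 2)%:E <= e%:E)%E.
  move=> uy.
  pose f k x : \bar R := ((v (k + K)%N x - y x) ^+ 2)%:E.
  have mf k : measurable_fun setT (f k).
    by apply/measurable_EFinP; apply: measurable_funX; apply: measurable_funB.
  have f0 k x : setT x -> (0 <= f k x)%E by rewrite lee_fin sqr_ge0.
  have := fatou mu measurableT mf f0.
  have -> : (\int[mu]_x limn_einf (f ^~ x) = \int[mu]_x ((w x - y x) ^+ 2)%:E)%E.
    apply: eq_integral => x _; apply: (cvg_limn_einf_sup _).1.
    apply: cvg_EFin; first exact: nearW.
    have cvx : v (k + K)%N x @[k --> \oo] --> w x.
      by rewrite (cvg_shiftn K (v ^~ x)); exact: cv.
    have cvd : v (k + K)%N x - y x @[k --> \oo] --> w x - y x.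
      by apply: cvgB => //; exact: cvg_cst.
    by apply: cvgM.
  move=> h; apply: le_trans h _; apply: limn_einf_le => k.
  have := uy (k + K)%N (leq_addl _ _); rewrite -lee_fin -integral_sqr_l2dot; apply: le_trans.
  rewrite le_eqVlt; apply/orP; left; apply/eqP; apply: ae_eq_integral => //.
    by apply/measurable_EFinP; apply: measurable_funX; apply: measurable_funB.
  by apply: filterS aeG => x Gx _; rewrite /f /v patchE mem_set.
have [h hE] : exists h : H, h =1 (fun x => w x - u 0%N x).
  apply: (@L2_of_sqr _ _ _ mu (fun x => w x - u 0%N x)); first exact: measurable_funB.
  apply: (@le_lt_trans _ _ 1%:E); last by rewrite ltry.
  apply: (fat _ _ 0%N) => k _; rewrite ltW//.
  by have := hN 0%N (n_ k) (n_ 0%N); rewrite expr0; apply; rewrite ?nN// /n_ big_ord_recl addnCA leq_addr.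
pose W : H := h + u 0%N.
have WE x : W x = w x by rewrite (_ : W x = h x + u 0%N x)// hE subrK.
have strong e : 0 < e -> exists M, forall n, (M <= n)%N -> l2dot (W - w_ n) (W - w_ n) <= e.
  move=> e0; have [M hM] := cw e e0; exists M => n Mn.
  rewrite -lee_fin -integral_sqr_l2dot.
  apply: le_trans (fat (w_ n) e M _).
    by rewrite le_eqVlt; apply/orP; left; apply/eqP; apply: eq_integral => x _; rewrite /= -WE.
  by move=> k Mk; apply: ltW; apply: hM => //; exact: leq_trans (nk k).
exists W => g; apply/cvgrPdist_le => e e0.
(* Chosen so that both terms of Young's inequality are at most [e]; the added 1 covers [g = 0]. *)
pose t := (l2dot g g + 1) / e.
have gg1 : 0 < l2dot g g + 1 by rewrite ltr_wpDl// l2dot_ge0.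
have t0 : 0 < t by rewrite divr_gt0.
have et0 : 0 < e / t by rewrite divr_gt0.
have [M hM] := strong _ et0.
near=> n.
have Mn : (M <= n)%N by near: n; exact: nbhs_infty_ge.
rewrite -l2dotBl.
have hg : t^-1 * l2dot g g <= e.
  by rewrite /t invf_div mulrAC ler_pdivrMr// ler_pM2l// lerDl.
have hx : t * l2dot (W - w_ n) (W - w_ n) <= e by rewrite -ler_pdivlMl// mulrC hM.
have h1 := l2dot_le (W - w_ n) g t0.
have h2 := l2dot_le (- (W - w_ n)) g t0.
rewrite l2dotNl l2dotNl [l2dot (W - w_ n) (- _)]l2dotC l2dotNl opprK in h2.
by rewrite ler_norml; apply/andP; split; lra.
Unshelve. all: end_near. Qed.

End L2_complete.

(** * Spectral measures and functional calculus *)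

Section integral_inequality_from_sets.
Context d (T : measurableType d) (R : realType).
Import HBNNSimple.

Lemma nnsfun_values (s : {nnsfun T >-> R}) :
  exists2 l : seq R, uniq l & forall x, s x \in l.
Proof.
have [l lE] := (finite_seqP _).1 (@fimfunP _ _ s).
exists (undup l); first exact: undup_uniq.
move=> x; rewrite mem_undup.
by have : range s (s x) by [exists x]; rewrite lE.
Qed.

Lemma measurable_level (s : {nnsfun T >-> R}) (y : R) : measurable (s @^-1` [set y]).
Proof. exact: measurable_sfunP. Qed.

Lemma integral_comp_nnsfun (mu : {measure set T -> \bar R}) (s : {nnsfun T >-> R})
    (l : seq R) (F : R -> R) : uniq l -> (forall x, s x \in l) -> (forall y, 0 <= F y) ->
  (\int[mu]_x (F (s x))%:E = \sum_(y <- l) (F y)%:E * mu (s @^-1` [set y]))%E.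
Proof.
move=> ul sl F0.
transitivity (\int[mu]_x (\sum_(y <- l) (F y * \1_(s @^-1` [set y]) x)%:E))%E.
  apply: eq_integral => x _; rewrite sumEFin; congr EFin.
  rewrite (bigD1_seq (s x))//= indicE mem_set// mulr1 big1 ?addr0// => y ys.
  rewrite indicE memNset ?mulr0// => /= /eqP; rewrite eq_sym; exact/negP.
have mF y : measurable_fun setT (fun x => (F y * \1_(s @^-1` [set y]) x)%:E).
  by apply/measurable_EFinP; apply: measurable_funM.
have Fi0 y x : setT x -> (0 <= (F y * \1_(s @^-1` [set y]) x)%:E)%E.
  by rewrite lee_fin mulr_ge0.
rewrite (ge0_integral_sum mu measurableT mF Fi0).
apply: eq_bigr => y _.
have mi : measurable_fun setT (EFin \o (\1_(s @^-1` [set y]) : T -> R)).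
  by apply/measurable_EFinP; apply: measurable_indic; exact: measurable_level.
have i0 x : setT x -> (0 <= (EFin \o (\1_(s @^-1` [set y]) : T -> R)) x)%E by rewrite lee_fin.
transitivity ((F y)%:E * \int[mu]_x (\1_(s @^-1` [set y]) x)%:E)%E.
  exact: (ge0_integralZl_EFin mu measurableT i0 mi (F0 y)).
by rewrite integral_indic ?setIT//; exact: measurable_level.
Qed.

Variables al be ga : {measure set T -> \bar R}.
Hypothesis le_sets : forall B (c : R), measurable B -> 0 <= c ->
  ((2 * c)%:E * al B <= (c ^+ 2)%:E * be B + ga B)%E.

(** For a simple function, [c] is taken to be its value on each level set and the inequalities are
    summed; monotone convergence does the rest. *)
Lemma le_integral_of_sets (phi : T -> R) :
    measurable_fun setT phi -> (forall x, 0 <= phi x) ->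
  (\int[al]_x (2 * phi x)%:E <= \int[be]_x (phi x ^+ 2)%:E + ga setT)%E.
Proof.
move=> mphi phi0.
have mEphi : measurable_fun setT (EFin \o phi) by exact/measurable_EFinP.
pose s n : {nnsfun T >-> R} := nnsfun_approx measurableT mEphi n.
have scvg x : (s n x)%:E @[n --> \oo] --> (phi x)%:E.
  by apply: cvg_nnsfun_approx => // y _; rewrite lee_fin.
have snd : nondecreasing_seq (s : (T -> R)^nat) := nd_nnsfun_approx measurableT mEphi.
have sle n x : s n x <= phi x.
  have ndx : {homo (fun n => (s n x)%:E) : n m / (n <= m)%N >-> (n <= m)%E}.
    by move=> m k mk; rewrite lee_fin; exact/lefP/snd.
  rewrite -lee_fin; apply: (cvge_to_ge (scvg x)); near=> m.
  by apply: ndx; near: m; exact: nbhs_infty_ge.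
have step n : (\int[al]_x (2 * s n x)%:E <= \int[be]_x (phi x ^+ 2)%:E + ga setT)%E.
  have [l ul sl] := nnsfun_values (s n).
  apply: (@le_trans _ _ (\int[be]_x ((s n x) ^+ 2)%:E + ga setT)%E); last first.
    apply: leeD => //; apply: ge0_le_integral => //.
    - by move=> x _; rewrite lee_fin sqr_ge0.
    - by apply/measurable_EFinP; apply: measurable_funX.
    - by apply/measurable_EFinP; apply: measurable_funX.
    - by move=> x _; rewrite lee_fin lerXn2r// nnegrE.
  (* [integral_comp_nnsfun] wants an outer function that is nonnegative on the whole line, hence the
     absolute value. *)
  have -> : (\int[al]_x (2 * s n x)%:E = \int[al]_x (2 * `|s n x|)%:E)%E.
    by apply: eq_integral => x _; rewrite ger0_norm.
  rewrite (@integral_comp_nnsfun be _ _ (fun y => y ^+ 2) ul sl); last by move=> y; rewrite sqr_ge0.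
  rewrite (@integral_comp_nnsfun al _ _ (fun y => 2 * `|y|) ul sl)//.
  have -> : ga setT = (\sum_(y <- l) ga (s n @^-1` [set y]))%E.
    have := @integral_comp_nnsfun ga _ _ (fun=> 1) ul sl (fun=> ler01).
    rewrite integral_cst// mul1e => ->.
    by apply: eq_bigr => y _; rewrite mul1e.
  rewrite -big_split/=; apply: lee_sum => y _.
  have := @le_sets (s n @^-1` [set y]) `|y| (measurable_level _ _) (normr_ge0 _).
  by rewrite real_normK ?num_real.
have ms n : measurable_fun setT (fun x => (2 * s n x)%:E).
  by apply/measurable_EFinP; apply: measurable_funM.
have s0 n x : setT x -> (0 <= (2 * s n x)%:E)%E by rewrite lee_fin mulr_ge0.
have sndx x : setT x -> {homo (fun n => (2 * s n x)%:E) : n m / (n <= m)%N >-> (n <= m)%E}.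
  by move=> _ m k mk; rewrite lee_fin ler_pM2l//; exact/lefP/snd.
have -> : (\int[al]_x (2 * phi x)%:E = \int[al]_x limn (fun n => (2 * s n x)%:E))%E.
  apply: eq_integral => x _; apply/esym/cvg_lim => //.
  apply: cvg_EFin; first exact: nearW.
  have := scvg x => /fine_cvg /= c1.
  by apply: cvgM; [exact: cvg_cst|exact: c1].
rewrite (monotone_convergence al measurableT ms s0 sndx).
apply: lime_le; last exact: nearW.
apply: ereal_nondecreasing_is_cvgn => m k mk; apply: ge0_le_integral => //.
  by move=> x Dx; exact: s0.
by move=> x Dx; exact: sndx.
Unshelve. all: end_near. Qed.

End integral_inequality_from_sets.

(** * Total variation of the spectral charges *)

Section spectral_variation.
Context d (T : measurableType d) (R : realType).
Variable mu : {measure set T -> \bar R}.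
Variable P : resolution mu.
Local Notation H := (L2 mu).
Local Notation RR := (measurableTypeR R).
Implicit Types (f g : H) (B C : set RR).

Definition spectral_tv f g : {measure set RR -> \bar R} :=
  charge_variation (hahnP (spectral_charge P f g)).
Definition spectral_pos f g : {finite_measure set RR -> \bar R} :=
  jordan_pos (hahnP (spectral_charge P f g)).
Definition spectral_neg f g : {finite_measure set RR -> \bar R} :=
  jordan_neg (hahnP (spectral_charge P f g)).

Lemma proj_dotI B C f g : measurable B -> measurable C ->
  l2dot (P B f) (P C g) = l2dot (P (B `&` C) f) g.
Proof.
move=> mB mC; rewrite -(proj_sym P mC) setIC; apply: l2dot_ae_eq.
by have := projI P mC mB f; apply: filterS => x /= /(_ I) -> _.
Qed.

Lemma proj_dot_ge0 B f : measurable B -> 0 <= l2dot (P B f) f.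
Proof. by move=> mB; rewrite -[B in P B f]setIid -proj_dotI// l2dot_ge0. Qed.

Lemma proj_dotU B C f g : measurable B -> measurable C -> B `&` C = set0 ->
  l2dot (P (B `|` C) f) g = l2dot (P B f) g + l2dot (P C f) g.
Proof.
move=> mB mC BC; have := chargeU (spectral_charge P f g) mB mC BC.
by rewrite /spectral_charge => -[].
Qed.

Lemma proj_dot0 f g : l2dot (P set0 f) g = 0.
Proof. by have [] := charge0 (spectral_charge P f g). Qed.

Lemma proj_dotT f g : l2dot (P setT f) g = l2dot f g.
Proof. exact: l2dot_ae_eq (projT P f). Qed.

Lemma spectral_posE f g B : measurable B ->
  spectral_pos f g B = (l2dot (P (B `&` hahn_pos (spectral_charge P f g)) f) g)%:E.
Proof.
move=> mB; transitivity (jordan_pos (hahnP (spectral_charge P f g)) B) => //.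
by rewrite jordan_posE cjordan_posE /crestr0 mem_set.
Qed.

Lemma spectral_negE f g B : measurable B ->
  spectral_neg f g B = (- l2dot (P (B `&` hahn_neg (spectral_charge P f g)) f) g)%:E.
Proof.
move=> mB; transitivity (jordan_neg (hahnP (spectral_charge P f g)) B) => //.
by rewrite jordan_negE cjordan_negE /crestr0 mem_set.
Qed.

Lemma spectral_tvE f g B : spectral_tv f g B = (spectral_pos f g B + spectral_neg f g B)%E.
Proof. by []. Qed.

Lemma spectral_split f g B : measurable B ->
  let Bp := B `&` hahn_pos (spectral_charge P f g) in
  let Bn := B `&` hahn_neg (spectral_charge P f g) in
  [/\ measurable Bp, measurable Bn, Bp `|` Bn = B & Bp `&` Bn = set0].
Proof.
move=> mB Bp Bn; have [[mp _] [mn _] pn pn0] := hahnP (spectral_charge P f g).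
split; [exact: measurableI|exact: measurableI| |].
  by rewrite /Bp /Bn -setIUr pn setIT.
by rewrite /Bp /Bn setIACA pn0 setI0.
Qed.

(** Flip the sign of [f] on the negative Hahn part: [x = c (P Bp f - P Bn f)] satisfies
    [<x, P B g> = c |nu_fg|(B)], and [<x, x> = c^2 nu_ff(B)] since the cross terms are projections
    onto the empty set. Young's inequality with [t = 1] concludes. *)
Lemma spectral_tv_le f g B (c : R) : measurable B -> 0 <= c ->
  ((2 * c)%:E * spectral_tv f g B <= (c ^+ 2)%:E * spectral_tv f f B + spectral_tv g g B)%E.
Proof.
move=> mB c0.
have [mp mn pn pn0] := spectral_split f g mB.
set Bp := _ `&` _ in mp pn pn0; set Bn := _ `&` _ in mn pn pn0.
have diag h : ((l2dot (P B h) h)%:E <= spectral_tv h h B)%E.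
  have := abse_charge_variation (hahnP (spectral_charge P h h)) mB.
  by apply: le_trans; rewrite lee_fin ler_norm.
pose x : H := c *: (P Bp f - P Bn f); pose y : H := P B g.
have BpB : Bp `&` B = Bp by rewrite /Bp setIAC setIid.
have BnB : Bn `&` B = Bn by rewrite /Bn setIAC setIid.
have xy : l2dot x y = c * (l2dot (P Bp f) g - l2dot (P Bn f) g).
  by rewrite /x /y l2dotZl l2dotBl !proj_dotI// BpB BnB.
have xx : l2dot x x = c ^+ 2 * l2dot (P B f) f.
  rewrite /x l2dotZl l2dotZr l2dotBl !l2dotBr !proj_dotI// !setIid.
  rewrite [Bn `&` Bp]setIC pn0 proj_dot0 -[in RHS]pn proj_dotU//; ring.
have yy : l2dot y y = l2dot (P B g) g by rewrite /y proj_dotI// setIid.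
have := l2dot_le x y ltr01; rewrite invr1 !mul1r xy xx yy => h.
apply: (@le_trans _ _ ((c ^+ 2)%:E * (l2dot (P B f) f)%:E + (l2dot (P B g) g)%:E)%E); last first.
  by apply: leeD => //; apply: lee_wpmul2l => //; rewrite lee_fin sqr_ge0.
rewrite spectral_tvE spectral_posE// spectral_negE// -EFinD -!EFinM -EFinD lee_fin.
by move: h; rewrite -/Bp -/Bn; lra.
Qed.

(** Projections make [nu_gg] nonnegative, so the sign change on the negative Hahn part can only
    lower the total. *)
Lemma spectral_tv_total g : (spectral_tv g g setT <= (l2dot g g)%:E)%E.
Proof.
have [mp mn pn pn0] := spectral_split g g (@measurableT _ RR).
rewrite spectral_tvE spectral_posE// spectral_negE// -EFinD lee_fin.
set Bp := _ `&` _ in mp pn pn0 *; set Bn := _ `&` _ in mn pn pn0 *.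
have := proj_dot_ge0 g mn; have := proj_dotT g g; rewrite -pn proj_dotU//; lra.
Qed.

Lemma spectral_integral_le f g (phi : R -> R) :
    measurable_fun (setT : set RR) phi -> (forall a, 0 <= phi a) ->
  (\int[spectral_tv f g]_a (2 * phi a)%:E <=
   \int[spectral_tv f f]_a (phi a ^+ 2)%:E + (l2dot g g)%:E)%E.
Proof.
move=> mphi phi0.
apply: le_trans (le_integral_of_sets (spectral_tv_le f g) mphi phi0) _.
by apply: leeD => //; exact: spectral_tv_total.
Qed.

End spectral_variation.

Lemma dominated_cvg_Rintegral d (T : measurableType d) (R : realType)
    (m : {measure set T -> \bar R}) (u : nat -> T -> R) (h G : T -> R) :
    (forall n, measurable_fun setT (u n)) -> measurable_fun setT h ->
    (forall x, u n x @[n --> \oo] --> h x) -> m.-integrable setT (EFin \o G) ->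
    (forall n x, `|u n x| <= G x) ->
  \int[m]_x u n x @[n --> \oo] --> \int[m]_x h x.
Proof.
move=> mu_ mh uh iG uG.
have hG x : `|h x| <= G x.
  by apply: (cvgr_to_le (cvg_norm (uh x))); apply: nearW => n; exact: uG.
apply: fine_cvg; rewrite fineK; last first.
  apply: integrable_fin_num => //; apply: le_integrable iG => //.
    exact/measurable_EFinP.
  by move=> x _ /=; rewrite lee_fin (le_trans (hG x))// ler_norm.
apply: (@dominated_cvg _ _ _ m _ measurableT (fun n x => (u n x)%:E) _ (EFin \o G)) => //=.
- by move=> n; apply/measurable_EFinP.
- by move=> x _; apply: cvg_EFin; [exact: nearW|exact: uh].
- by move=> n x _; rewrite lee_fin.
Qed.

Lemma EFin_Rintegral d (T : measurableType d) (R : realType)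
    (m : {measure set T -> \bar R}) (h : T -> R) :
  m.-integrable setT (EFin \o h) -> (\int[m]_x (h x)%:E)%E = (\int[m]_x h x)%:E.
Proof. by move=> ih; rewrite /Rintegral fineK//; exact: integrable_fin_num. Qed.

(** * Vectors obtained from functions of the operator *)

Section functional_calculus.
Context d (T : measurableType d) (R : realType).
Variable mu : {measure set T -> \bar R}.
Variable P : resolution mu.
Local Notation H := (L2 mu).
Local Notation RR := (measurableTypeR R).
Import HBNNSimple.

Lemma integral_spectral_tv (f g : H) (D : set RR) (h : RR -> \bar R) :
    measurable D -> measurable_fun D h -> (forall a, D a -> (0 <= h a)%E) ->
  (\int[spectral_tv P f g]_(a in D) h a =
   \int[spectral_pos P f g]_(a in D) h a + \int[spectral_neg P f g]_(a in D) h a)%E.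
Proof.
move=> mD mh h0.
transitivity (\int[measure_add (spectral_pos P f g) (spectral_neg P f g)]_(a in D) h a)%E.
  by apply: eq_measure_integral => B mB _; rewrite spectral_tvE; exact/esym/measure_addE.
exact: ge0_integral_measure_add.
Qed.

Lemma integrable_spectral_tv (f g : H) (D : set RR) (h : RR -> \bar R) : measurable D ->
  (spectral_tv P f g).-integrable D h <->
  (spectral_pos P f g).-integrable D h /\ (spectral_neg P f g).-integrable D h.
Proof.
move=> mD; split.
  move=> /integrableP[mh]; rewrite integral_spectral_tv//; last exact: measurableT_comp.
  move=> ih; have p0 : (0 <= \int[spectral_pos P f g]_(a in D) `|h a|)%E by exact: integral_ge0.
  have n0 : (0 <= \int[spectral_neg P f g]_(a in D) `|h a|)%E by exact: integral_ge0.
  by split; apply/integrableP; split => //; apply: le_lt_trans ih; [rewrite leeDl|rewrite leeDr].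
move=> [/integrableP[mh ip] /integrableP[_ ineg]]; apply/integrableP; split => //.
rewrite integral_spectral_tv//; last exact: measurableT_comp.
by rewrite lte_add_pinfty.
Qed.

Definition spectral_int (f g : H) (phi : R -> R) : R :=
  \int[spectral_pos P f g]_a phi a - \int[spectral_neg P f g]_a phi a.

Lemma fpairingE (f g : H) (phi : R -> R) :
  fpairing P phi f g = spectral_int f g (phi \_ `[0, +oo[).
Proof.
by rewrite /fpairing /charge_integral /spectral_int; congr (_ - _); rewrite Rintegral_mkcond.
Qed.

Lemma l2dot_sum (l : seq R) (F : R -> H) (g : H) :
  l2dot (\sum_(y <- l) F y) g = \sum_(y <- l) l2dot (F y) g.
Proof.
elim: l => [|y l IH]; first by rewrite !big_nil l2dot0l.
by rewrite !big_cons l2dotDl IH.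
Qed.

(** For a simple function the calculus is a finite combination of the projections onto its level
    sets. *)
Lemma nnsfun_calculus (f : H) (s : {nnsfun RR >-> R}) :
  exists w : H, forall g, l2dot w g = spectral_int f g s.
Proof.
have [l ul sl] := nnsfun_values s.
pose B y := s @^-1` [set y].
have mB y : measurable (B y) by exact: measurable_level.
exists (\sum_(y <- l) `|y| *: P (B y) f) => g.
have E (m : {measure set RR -> \bar R}) (c : R -> R) : (forall y, m (B y) = (c y)%:E) ->
    \int[m]_a s a = \sum_(y <- l) `|y| * c y.
  move=> mc; rewrite /Rintegral.
  have -> : (\int[m]_a (s a)%:E = \int[m]_a `|s a|%:E)%E.
    by apply: eq_integral => a _; rewrite ger0_norm.
  rewrite (@integral_comp_nnsfun _ _ _ m s l (fun y => `|y|) ul sl)//.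
  by under eq_bigr do rewrite mc -EFinM; rewrite sumEFin.
rewrite /spectral_int (E _ _ (fun y => spectral_posE P f g (mB y))).
rewrite (E _ _ (fun y => spectral_negE P f g (mB y))) l2dot_sum -sumrB.
apply: eq_bigr => y _; rewrite l2dotZl -mulrBr opprK; congr (_ * _).
have [mp mn pn pn0] := spectral_split P f g (mB y).
by rewrite -[in LHS]pn proj_dotU.
Qed.

Lemma spectral_int_le (f g : H) (h : R -> R) : (spectral_tv P f g).-integrable setT (EFin \o h) ->
  ((spectral_int f g h)%:E <= \int[spectral_tv P f g]_a `|h a|%:E)%E.
Proof.
move=> ih; have [ip ineg] := (integrable_spectral_tv f g (EFin \o h) (@measurableT _ RR)).1 ih.
have /integrableP[/measurable_EFinP mh _] := ih.
rewrite integral_spectral_tv//; last by apply/measurable_EFinP; exact: measurableT_comp.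
have fe (m : {measure set RR -> \bar R}) : m.-integrable setT (EFin \o h) ->
    (\int[m]_a `|h a|%:E = (\int[m]_a `|h a|)%:E)%E.
  by move=> im; rewrite /Rintegral fineK//; apply: integrable_fin_num => //; exact: integrable_abse im.
rewrite !fe// -EFinD lee_fin /spectral_int lerD//.
  by apply: le_trans (le_normr_Rintegral _ _) => //; exact: ler_norm.
by apply: le_trans (le_normr_Rintegral _ _) => //; rewrite -normrN ler_norm.
Qed.

Lemma spectral_intB (f g : H) (h1 h2 : R -> R) :
    (spectral_tv P f g).-integrable setT (EFin \o h1) ->
    (spectral_tv P f g).-integrable setT (EFin \o h2) ->
  spectral_int f g (fun a => h1 a - h2 a) = spectral_int f g h1 - spectral_int f g h2.
Proof.
move=> /(integrable_spectral_tv f g _ (@measurableT _ RR))[p1 n1].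
move=> /(integrable_spectral_tv f g _ (@measurableT _ RR))[p2 n2].
by rewrite /spectral_int !RintegralB//; ring.
Qed.

Variables (f : H) (phi : R -> R).
Hypothesis mphi : measurable_fun (`[0%R, +oo[%classic : set R) phi.
Hypothesis phi0 : forall a, 0 <= a -> 0 <= phi a.
Hypothesis dphi : fdomain P phi f.

(** Within this section [psi] is just [phi] cut off to the half line, not the function of the
    string. *)
Let psi : R -> R := phi \_ (`[0%R, +oo[%classic : set R).

Let mpsi : measurable_fun (setT : set RR) psi.
Proof. by apply/(measurable_restrictT _ _).1. Qed.

Let psi0 a : 0 <= psi a.
Proof. by rewrite /psi patchE mem_setE in_itv/= andbT; case: ifPn => // /phi0. Qed.

Let i2 : (spectral_tv P f f).-integrable setT (EFin \o (fun a => psi a ^+ 2)).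
Proof.
have : (spectral_tv P f f).-integrable setT ((EFin \o (fun a => phi a ^+ 2)) \_ `[0, +oo[).
  by apply/integrable_restrict => //; rewrite setTI.
apply: eq_integrable => // a _; rewrite /psi /= !patchE /=.
by case: ifPn => // _; rewrite expr0n.
Qed.

Let i1_dom g (h : R -> R) : measurable_fun (setT : set RR) h -> (forall a, `|h a| <= psi a) ->
  (spectral_tv P f g).-integrable setT (EFin \o h).
Proof.
move=> mh hpsi; apply/integrableP; split; first exact/measurable_EFinP.
have mah : measurable_fun (setT : set RR) (fun a => `|h a|) by exact: measurableT_comp.
have := spectral_integral_le P f g mah (fun a => normr_ge0 _) => hle.
apply: (@le_lt_trans _ _ (\int[spectral_tv P f g]_a (2 * `|h a|)%:E)%E).
  apply: ge0_le_integral => //.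
  - by apply/measurable_EFinP.
  - by apply/measurable_EFinP; exact: measurable_funM.
  - by move=> a _; rewrite lee_fin ler_peMl// ler1n.
apply: (le_lt_trans hle); apply: lte_add_pinfty; last exact: ltry.
have [mi2 i2f] := elimT (integrableP _ _ _) i2; apply: (le_lt_trans _ i2f); apply: ge0_le_integral => //.
- by apply/measurable_EFinP; apply: measurable_funX.
- by apply/measurable_EFinP; apply: measurableT_comp => //; apply: measurable_funX.
- by move=> a _; rewrite lee_fin [leRHS]ger0_norm ?sqr_ge0// lerXn2r// nnegrE.
Qed.

(** Simple functions increasing to [psi] give vectors [w n]; they form a Cauchy sequence because
    [r n], the squared distance of [s n] to [psi] for [nu_ff], tends to 0 by dominated
    convergence. *)
Lemma fcalc_exists : exists w : H, forall g,
  fpairing_defined P phi f g /\ l2dot w g = fpairing P phi f g.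
Proof.
have mEpsi : measurable_fun (setT : set RR) (EFin \o psi) by exact/measurable_EFinP.
pose s n : {nnsfun RR >-> R} := nnsfun_approx measurableT mEpsi n.
have scvg x : s n x @[n --> \oo] --> psi x.
  have : (s n x)%:E @[n --> \oo] --> (psi x)%:E.
    by apply: cvg_nnsfun_approx => // y _; rewrite lee_fin.
  by move/fine_cvg.
have snd : nondecreasing_seq (s : (RR -> R)^nat) := nd_nnsfun_approx measurableT mEpsi.
have sle n x : s n x <= psi x.
  apply: (cvgr_to_ge (scvg x)); near=> m; apply/lefP/snd.
  by near: m; exact: nbhs_infty_ge.
have s0 n x : 0 <= s n x by [].
have snorm n x : `|s n x| <= psi x by rewrite ger0_norm.
have dpsi n x : `|psi x - s n x| <= psi x.
  by rewrite ger0_norm ?subr_ge0// gerBl.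
have /choice[w wE] n := nnsfun_calculus f (s n).
have is1 g n : (spectral_tv P f g).-integrable setT (EFin \o s n) by exact: i1_dom.
pose r n := \int[spectral_tv P f f]_a ((psi a - s n a) ^+ 2).
have mr n : measurable_fun (setT : set RR) (fun a => (psi a - s n a) ^+ 2).
  by apply: measurable_funX; exact: measurable_funB.
have rdom n a : `|(psi a - s n a) ^+ 2| <= psi a ^+ 2.
  by rewrite normrX lerXn2r// nnegrE.
have ir n : (spectral_tv P f f).-integrable setT (EFin \o (fun a => (psi a - s n a) ^+ 2)).
  apply: le_integrable i2 => //; first exact/measurable_EFinP.
  by move=> a _ /=; rewrite lee_fin [leRHS]ger0_norm ?sqr_ge0// rdom.
have r0 : r n @[n --> \oo] --> (0 : R).
  have -> : 0 = \int[spectral_tv P f f]_a (cst 0 a) :> R by rewrite Rintegral_cst// mul0r.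
  apply: (dominated_cvg_Rintegral mr _ _ i2 rdom) => // a.
  rewrite /cst -[X in _ --> X](_ : (psi a - psi a) * (psi a - psi a) = _); last by rewrite subrr mulr0.
  by apply: cvgM; apply: cvgB => //; exact: cvg_cst.
(* With [x = w m - w n] and [h = s m - s n], [<x, x>] is the integral of [h] against [nu_fx]. The
   variation inequality with [g = x] gives [2 <x, x> <= int h^2 dnu_ff + <x, x>], and one [<x, x>]
   is absorbed. *)
have xle m n : l2dot (w m - w n) (w m - w n) <= 2 * (r m + r n).
  set x := w m - w n.
  pose h a := s m a - s n a.
  have hle a : `|h a| <= psi a.
    rewrite ler_norml /h; apply/andP; split.
      by rewrite lerBrDl lerBlDl -subr_ge0; have := sle n a; have := s0 m a; lra.
    by have := sle m a; have := s0 n a; lra.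
  have mh : measurable_fun (setT : set RR) h by exact: measurable_funB.
  have xx : l2dot x x = spectral_int f x h.
    by rewrite {1}/x l2dotBl !wE -spectral_intB.
  have ih := i1_dom x mh hle.
  have mah : measurable_fun (setT : set RR) (fun a => `|h a|) by exact: measurableT_comp.
  have h1 := spectral_int_le ih.
  have h2 := spectral_integral_le P f x mah (fun a => normr_ge0 _).
  have h3 : (\int[spectral_tv P f f]_a (`|h a| ^+ 2)%:E <=
             \int[spectral_tv P f f]_a (2 * ((psi a - s m a) ^+ 2 + (psi a - s n a) ^+ 2))%:E)%E.
    apply: ge0_le_integral => //.
    - by apply/measurable_EFinP; exact: measurable_funX.
    - by apply/measurable_EFinP; apply: measurable_funM => //; exact: measurable_funD.
    - move=> a _; rewrite lee_fin real_normK ?num_real// /h.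
      have := sqr_ge0 ((psi a - s m a) + (psi a - s n a)); lra.
  have iah : (spectral_tv P f x).-integrable setT (EFin \o (fun a => `|h a|)).
    exact: integrable_abse ih.
  have iah2 : (spectral_tv P f x).-integrable setT (EFin \o (fun a => 2 * `|h a|)).
    exact: (integrableZl measurableT 2 iah).
  have isq : (spectral_tv P f f).-integrable setT
      (EFin \o (fun a => (psi a - s m a) ^+ 2 + (psi a - s n a) ^+ 2)).
    exact: (integrableD measurableT (ir m) (ir n)).
  have isq2 : (spectral_tv P f f).-integrable setT
      (EFin \o (fun a => 2 * ((psi a - s m a) ^+ 2 + (psi a - s n a) ^+ 2))).
    exact: (integrableZl measurableT 2 isq).
  have := le_trans h2 (leeD2r _ h3); rewrite !EFin_Rintegral// -EFinD lee_fin.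
  move: h1; rewrite EFin_Rintegral// lee_fin -xx.
  rewrite RintegralZl// RintegralZl// RintegralD// -/(r m) -/(r n); lra.
have [w0 w0E] : exists w0 : H, forall g, l2dot (w n) g @[n --> \oo] --> l2dot w0 g.
  apply: l2_complete => e e0.
  have /cvgrPdist_lt/(_ (e / 4))[|N _ rN] := r0; first by rewrite divr_gt0.
  exists N => m n Nm Nn; apply: le_lt_trans (xle m n) _.
  have := rN m Nm; have := rN n Nn; rewrite /= !sub0r !normrN.
  by move=> /(le_lt_trans (ler_norm _)) + /(le_lt_trans (ler_norm _)); lra.
have ipsi g : (spectral_tv P f g).-integrable setT (EFin \o psi).
  by apply: i1_dom => // a; rewrite ger0_norm.
exists w0 => g; split.
  have : (spectral_tv P f g).-integrable setT ((EFin \o phi) \_ (`[0%R, +oo[%classic : set RR)).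
    have := ipsi g; apply: eq_integrable => // a _; rewrite /psi /= !patchE /=.
    by case: ifPn.
  by move/(integrable_restrict _ _); rewrite setTI; exact.
rewrite fpairingE; apply: (cvg_unique _ (w0E g)) => //.
rewrite (_ : (fun n => l2dot (w n) g) = (fun n => spectral_int f g (s n))); last first.
  by apply/funext => n; rewrite wE.
have [pp pn] := (integrable_spectral_tv f g (EFin \o psi) (@measurableT _ RR)).1 (ipsi g).
by apply: cvgB; apply: (dominated_cvg_Rintegral _ mpsi scvg _ snorm).
Unshelve. all: end_near. Qed.

Lemma fcalcP (g : H) :
  fpairing_defined P phi f g /\ l2dot (fcalc P phi f) g = fpairing P phi f g.
Proof. exact: (xgetPex (0 : H) fcalc_exists). Qed.

End functional_calculus.

(** * The extension *)

Section weak_derivatives.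
Context (R : realType).
Local Notation leb := (@lebesgue_measure R).

Lemma locally_integrable_mul_test (h eta : R -> R) n :
    locally_integrable `]0, +oo[ h -> test_function eta ->
  leb.-integrable `]0, +oo[ (EFin \o (fun t => h t * derive1n n eta t)).
Proof.
move=> [mh _ ih] te; have [a [b [a0 ab out]]] := test_function_supp te.
have sub : (`[a, b]%classic : set R) `<=` `]0, +oo[.
  by move=> t; rewrite /= !in_itv/= andbT => /andP[/(lt_le_trans a0)].
have hab : leb.-integrable `[a, b] (EFin \o h).
  apply/integrableP; split; last exact: (ih _ sub (@segment_compact _ a b)).
  by apply/measurable_EFinP; apply: measurable_funS mh.
have := @integrable_mul_test _ (h \_ `[a, b]) eta n te.
have gi c : 0 <= c -> leb.-integrable `[0, c] (EFin \o (h \_ `[a, b])).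
  move=> c0; apply: (@integrableS _ _ _ _ setT) => //.
  by rewrite -restrict_EFin; apply/integrable_restrict => //; rewrite setTI.
move=> /(_ gi); congr integrable; apply/funext => t /=; congr EFin.
rewrite patchE mem_setE in_itv/=; case: ifPn => // /out out0.
by rewrite out0 !mulr0.
Qed.

Lemma weak_deriv2B (h1 w1 h2 w2 : R -> R) : weak_deriv2 h1 w1 -> weak_deriv2 h2 w2 ->
  weak_deriv2 (fun z => h1 z - h2 z) (fun z => w1 z - w2 z).
Proof.
move=> [lh1 lw1 e1] [lh2 lw2 e2]; split; [exact: locally_integrableB|exact: locally_integrableB|].
move=> eta te.
have E (p q : R -> R) n : locally_integrable `]0, +oo[ p -> locally_integrable `]0, +oo[ q ->
    \int[leb]_(z in `]0, +oo[) ((p z - q z) * derive1n n eta z) =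
    \int[leb]_(z in `]0, +oo[) (p z * derive1n n eta z) -
    \int[leb]_(z in `]0, +oo[) (q z * derive1n n eta z).
  move=> lp lq; rewrite -RintegralB//; [|exact: locally_integrable_mul_test..].
  by apply: eq_Rintegral => z _; rewrite mulrBl.
by rewrite (E _ _ 2%N)// (E _ _ 0%N)// e1// e2.
Qed.

Lemma eq_locally_integrable (h k : R -> R) : (forall z, 0 < z -> h z = k z) ->
  locally_integrable `]0, +oo[ h -> locally_integrable `]0, +oo[ k.
Proof.
move=> hk [mh op ih]; split => //.
  by apply: eq_measurable_fun mh => z; rewrite inE/= in_itv/= andbT => /hk.
move=> K Kp cK; rewrite (_ : (\int[leb]_(x in K) _ = \int[leb]_(x in K) `|h x|%:E)%E).
  exact: ih.
apply: eq_integral => z; rewrite inE => /Kp; rewrite /= in_itv/= andbT => z0.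
by rewrite hk.
Qed.

Lemma eq_weak_deriv2 (h k w x : R -> R) : (forall z, 0 < z -> h z = k z) ->
  (forall z, 0 < z -> w z = x z) -> weak_deriv2 h w -> weak_deriv2 k x.
Proof.
move=> hk wx [lh lw e]; split.
- exact: eq_locally_integrable lh.
- exact: eq_locally_integrable lw.
move=> eta te; transitivity (\int[leb]_(z in `]0, +oo[) (h z * derive1n 2 eta z)).
  by apply: eq_Rintegral => z; rewrite inE/= in_itv/= andbT => z0; rewrite hk.
rewrite e//; apply: eq_Rintegral => z; rewrite inE/= in_itv/= andbT => z0.
by rewrite wx.
Qed.

End weak_derivatives.

Lemma RintegralN d (T : measurableType d) (R : realType) (m : {measure set T -> \bar R})
    (D : set T) (h : T -> R) : measurable D -> m.-integrable D (EFin \o h) ->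
  \int[m]_(x in D) (- h x) = - \int[m]_(x in D) h x.
Proof.
move=> mD ih; transitivity (\int[m]_(x in D) (-1 * h x)).
  by apply: eq_Rintegral => x _; rewrite mulN1r.
by rewrite RintegralZl// mulN1r.
Qed.

(** * The calculus applied to the string *)

Section krein_calculus.
Context d (T : measurableType d) (R : realType).
Variable mu : {measure set T -> \bar R}.
Variable P : resolution mu.
Local Notation H := (L2 mu).
Local Notation RR := (measurableTypeR R).
Local Notation leb := (@lebesgue_measure R).

Lemma fdomain_le (f : H) (phi chi : R -> R) :
    measurable_fun (`[0%R, +oo[%classic : set R) phi ->
    (forall a, 0 <= a -> `|phi a| <= `|chi a|) ->
  fdomain P chi f -> fdomain P phi f.
Proof.
move=> mphi le; rewrite /fdomain /= /charge_integrable; apply: le_integrable => //.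
  by apply/measurable_EFinP; exact: measurable_funX.
move=> a; rewrite /= in_itv/= andbT => a0.
by rewrite lee_fin !normrX lerXn2r// ?nnegrE// le.
Qed.

Lemma fdomain_cst (f : H) (c : R) : fdomain P (cst c) f.
Proof.
apply/(integrable_spectral_tv P f f (EFin \o (fun=> c ^+ 2)) (measurable_itv _)).
by split; exact: finite_measure_integrable_cst.
Qed.

Variables (A : R -> R) (r : R -> R -> R) (f : H).
Hypothesis hA : krein_string A.
Hypothesis hr : forall a, 0 <= a -> krein_solution A a (fun z => r z a).
Hypothesis hf : fdomain P (krein_psi r) f.

Local Notation v := (fun z => fcalc P (r z) f).

Let psiP g : fpairing_defined P (krein_psi r) f g /\
  l2dot (fcalc P (krein_psi r) f) g = fpairing P (krein_psi r) f g.
Proof. exact: fcalcP (measurable_krein_psi hA hr) (krein_psi_ge0 hA hr) hf g. Qed.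

Let psi_int g : (spectral_pos P f g).-integrable `[0, +oo[ (EFin \o krein_psi r) /\
  (spectral_neg P f g).-integrable `[0, +oo[ (EFin \o krein_psi r).
Proof. exact/(integrable_spectral_tv P f g _ (measurable_itv _))/(psiP g).1. Qed.

Let psi_pos g := (psi_int g).1.
Let psi_neg g := (psi_int g).2.

Lemma l2dot_krein z g : 0 <= z -> l2dot (fcalc P (r z) f) g =
  \int[spectral_pos P f g]_(a in `[0, +oo[) r z a -
  \int[spectral_neg P f g]_(a in `[0, +oo[) r z a.
Proof.
move=> z0; have b a := krein_bounds hr z0.
have mr := measurable_r_a hA hr z0.
have r0 a : 0 <= a -> 0 <= r z a by move=> /(krein_bounds hr z0)/andP[].
have dr : fdomain P (r z) f.
  apply: fdomain_le mr _ (fdomain_cst f 1) => a a0.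
  by rewrite normr1 ger0_norm ?r0//; have /andP[] := krein_bounds hr z0 a0.
exact: (fcalcP mr r0 dr g).2.
Qed.

(** The superposition result holds for the positive and the negative part of the spectral charge,
    both finite and integrating [psi]; the equation for the pairing is their difference. *)
Lemma extension_equation : extension_weak_solution P A r f v.
Proof.
move=> g; split.
  have hp := ae_krein_ALv hA hr (psi_pos g); have hn := ae_krein_ALv hA hr (psi_neg g).
  apply: (@filterS2 _ _ (ae_filter_ringOfSetsType leb) _ _ _ _ hp hn) => z zp zn z0.
  by apply/(integrable_spectral_tv P f g _ (measurable_itv _)); split; [exact: zp|exact: zn].
apply: eq_weak_deriv2 (weak_deriv2B (krein_weak_rho hA hr (psi_pos g))
                                    (krein_weak_rho hA hr (psi_neg g))).
  by move=> z z0; rewrite l2dot_krein// ltW.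
by move=> z z0; rewrite -opprB opprK addrC.
Qed.

(** The symbol is 1 on [[0, +oo[], and the projection onto that half line is the identity. *)
Lemma fcalc_krein0 : fcalc P (r 0) f = f %[ae mu].
Proof.
apply: l2dot_inj => g; rewrite l2dot_krein//.
transitivity (l2dot (P (`[0, +oo[%classic : set RR) f) g); last first.
  exact: l2dot_ae_eq (proj_ge0 P f).
have mD : measurable (`[0%R, +oo[%classic : set RR) by exact: measurable_itv.
have E (m : {finite_measure set RR -> \bar R}) :
    \int[m]_(a in `[0, +oo[) r 0 a = fine (m (`[0%R, +oo[%classic : set RR)).
  transitivity (\int[m]_(a in (`[0%R, +oo[%classic : set RR)) 1).
    by apply: eq_Rintegral => a; rewrite inE/= in_itv/= andbT => /(krein0 hr).
  by rewrite Rintegral_cst// mul1r.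
rewrite !E spectral_posE// spectral_negE//= opprK.
have [mp mn pn pn0] := spectral_split P f g mD.
by rewrite -proj_dotU// pn.
Qed.

(** [fcalcP] covers nonnegative symbols and the slope is nonpositive, hence the two minus signs. *)
Lemma l2dot_krein_deriv z g : 0 < z ->
  l2dot (- fcalc P (fun a => - krein_deriv A r z a) f) g =
  \int[spectral_pos P f g]_(a in `[0, +oo[) krein_deriv A r z a -
  \int[spectral_neg P f g]_(a in `[0, +oo[) krein_deriv A r z a.
Proof.
move=> z0.
have md : measurable_fun (`[0%R, +oo[%classic : set R) (fun a => - krein_deriv A r z a).
  by apply: measurable_funN; exact: (measurable_krein_deriv hA hr z0).
have d0 a : 0 <= a -> 0 <= - krein_deriv A r z a.
  by move=> a0; rewrite oppr_ge0; exact: (krein_deriv_le0 hA hr (ltW z0) a0).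
have dd : fdomain P (fun a => - krein_deriv A r z a) f.
  apply: fdomain_le md _ hf => a a0; rewrite normrN.
  apply: le_trans (krein_deriv_norm_le hA hr (ltW z0) a0) _; exact: ler_norm.
rewrite l2dotNl (fcalcP md d0 dd g).2 /fpairing /charge_integral.
have E (m : {finite_measure set RR -> \bar R}) :
    m.-integrable `[0, +oo[ (EFin \o krein_psi r) ->
    \int[m]_(a in `[0, +oo[) (- krein_deriv A r z a) =
    - \int[m]_(a in `[0, +oo[) krein_deriv A r z a.
  by move=> ipsi; rewrite RintegralN//; exact: (integrable_krein_deriv hA hr ipsi z0).
rewrite (E (spectral_pos P f g) (psi_pos g)) (E (spectral_neg P f g) (psi_neg g)).
by rewrite opprB opprK addrC.
Qed.

Lemma weak_derive_krein z : 0 < z ->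
  is_weak_derive v z (- fcalc P (fun a => - krein_deriv A r z a) f).
Proof.
move=> z0 g; rewrite l2dot_krein_deriv//.
have dp := is_derive_Rintegral_r hA hr (psi_pos g) z0.
have dn := is_derive_Rintegral_r hA hr (psi_neg g) z0.
apply: near_eq_is_derive (is_deriveB dp dn).
near=> s; rewrite l2dot_krein//.
have : 0 < s by near: s; exact: lt_nbhsr.
exact: ltW.
Unshelve. all: end_near. Qed.

(** Dominated convergence at 0+ for each Hahn part separately, then the difference of the two
    limits. *)
Lemma weak_lim0_krein :
  weak_lim0 (fun z => - fcalc P (fun a => - krein_deriv A r z a) f) (- fcalc P (krein_psi r) f).
Proof.
move=> g; rewrite l2dotNl (psiP g).2 /fpairing /charge_integral.
have mD : measurable (`[0%R, +oo[%classic : set RR) by exact: measurable_itv.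
have cp := Rintegral_krein_deriv_cvg0 hA hr (psi_pos g).
have cn := Rintegral_krein_deriv_cvg0 hA hr (psi_neg g).
rewrite (RintegralN mD (psi_pos g)) in cp.
rewrite (RintegralN mD (psi_neg g)) in cn.
rewrite -[X in _ --> X](_ : - (\int[spectral_pos P f g]_(a in `[0, +oo[) krein_psi r a) -
  - (\int[spectral_neg P f g]_(a in `[0, +oo[) krein_psi r a) = _); last first.
  by rewrite opprB opprK addrC.
apply: cvg_trans (cvgB cp cn); apply: near_eq_cvg; near=> z.
rewrite l2dot_krein_deriv//; near: z; exact: nbhs_right_gt.
Unshelve. all: end_near. Qed.

End krein_calculus.

Theorem theorem3p2 (R : realType) (X : pmetricType R)
    (mu : {measure set (borel X) -> \bar R})
    (hX : locally_compact [set: X]) (hmu : radon_measure mu)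
    (hsupp : full_support mu)
    (F : set (L2 mu)) (E : L2 mu -> L2 mu -> R) (hE : dirichlet_form F E)
    (D : set (L2 mu)) (L : L2 mu -> L2 mu)
    (hL : self_adjoint D L) (hLneg : nonpositive_op D L)
    (P : resolution mu) (hP : resolution_of_opp P D L)
    (hgen : generator_of P F E)
    (hgap : no_spectral_gap D L)
    (A : R -> R) (hA : krein_string A)
    (r : R -> R -> R)
    (hr : forall a, 0 <= a -> krein_solution A a (fun z => r z a))
    (f : L2 mu) (hf : fdomain P (krein_psi r) f) :
  let v := fun z : R => fcalc P (r z) f in
  [/\ extension_weak_solution P A r f v,
      v 0 = f %[ae mu]
    & exists vz : R -> L2 mu,
        (forall z, 0 < z -> is_weak_derive v z (vz z)) /\
        weak_lim0 vz (- fcalc P (krein_psi r) f)].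
Proof.
move=> v; split; [exact: extension_equation|exact: (fcalc_krein0 P f hA hr)|].
exists (fun z => - fcalc P (fun a => - krein_deriv A r z a) f); split.
  by move=> z z0; exact: weak_derive_krein.
exact: weak_lim0_krein.
Qed.
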